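(* For every $n>2$, the edge splitting graph $\mathcal{ES}_n^1$ is not hyperbolic in the sense of Gromov.
   Context: Edge splitting graph $\mathcal{ES}_n^1$ of the free group $F_n$ of rank $n$: vertices are conjugacy classes $[A*B]$ of free factorizations $F_n=A*B$ into two nontrivial free factors (unordered pair, both factors conjugated simultaneously by one element of $F_n$). Two distinct vertices are joined by an edge if they have representatives $A_1*B_1$, $A_2*B_2$ with a common refinement which is a free factorization of $F_n$ into three nontrivial factors. The graph carries the path metric with edges of length 1. *)

(* Defs.v *)
From HB Require Import structures.
From mathcomp Require Import all_boot all_order all_algebra.
From mathcomp Require Import all_classical all_reals ereal.
Set Implicit Arguments.
Unset Strict Implicit.
Unset Printing Implicit Defensive.
Import Order.TTheory GRing.Theory Num.Theory.
Local Open Scope classical_set_scope.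
Local Open Scope ring_scope.

(* The free group of rank n: freely reduced words in the letters x_i ^ (+-1),
   the sign being the boolean (true for the inverse). *)

Definition letter (n : nat) : Type := ('I_n * bool)%type.

Definition inv_letter (n : nat) (a : letter n) : letter n := (a.1, ~~ a.2).

Definition freely_reduced (n : nat) (w : seq (letter n)) : bool :=
  sorted (fun a b => b != inv_letter a) w.

Record free_group (n : nat) : Type := FreeGroup {
  free_word : seq (letter n);
  free_wordP : freely_reduced free_word
}.

HB.instance Definition _ (n : nat) := [isSub for @free_word n].
HB.instance Definition _ (n : nat) := [Choice of free_group n by <:].

Section FreeGroup.
Variable n : nat.
Implicit Types (a b : letter n) (u v w : seq (letter n)).

Definition cons_reduce a w : seq (letter n) :=
  if w is b :: w' then if b == inv_letter a then w' else a :: w else [:: a].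

(* The reduced form of u ++ v, for v reduced. *)
Definition cat_reduce u v : seq (letter n) := foldr cons_reduce v u.

Definition inv_word w : seq (letter n) := rev (map (@inv_letter n) w).

Lemma inv_letterK : involutive (@inv_letter n).
Proof. by case=> i b; rewrite /inv_letter /= negbK. Qed.

Lemma cons_reduce_reduced a w :
  freely_reduced w -> freely_reduced (cons_reduce a w).
Proof.
case: w => [//|b w] /= rw; case: eqVneq => [_|ab] /=; last by rewrite ab.
by case: w rw => [//|c w] /= /andP[].
Qed.

Lemma cat_reduce_reduced u v :
  freely_reduced v -> freely_reduced (cat_reduce u v).
Proof. by move=> rv; elim: u => [//|a u IH]; exact: cons_reduce_reduced. Qed.

Lemma cons_reduceK a w :
  freely_reduced w -> cons_reduce a (cons_reduce (inv_letter a) w) = w.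
Proof.
case: w => [|b w] /= rw; first by rewrite eqxx.
rewrite inv_letterK; case: eqVneq rw => [-> | _ _] /=; last by rewrite eqxx.
by case: w => [//|c w] /= /andP[/negbTE ->].
Qed.

Lemma cat_cons_reduce a v w : freely_reduced w ->
  cat_reduce (cons_reduce a v) w = cons_reduce a (cat_reduce v w).
Proof.
move=> rw; case: v => [//|b v] /=; case: eqVneq => [->|//].
by rewrite cons_reduceK// cat_reduce_reduced.
Qed.

Lemma cat_reduceA u v w : freely_reduced w ->
  cat_reduce u (cat_reduce v w) = cat_reduce (cat_reduce u v) w.
Proof. by move=> rw; elim: u => [//|a u IH] /=; rewrite cat_cons_reduce// IH. Qed.

Lemma cat_reduce0 w : freely_reduced w -> cat_reduce w [::] = w.
Proof.
elim: w => [//|a w IH] /= rw.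
rewrite IH; last exact: path_sorted rw.
by case: w rw {IH} => [//|b w] /= /andP[/negbTE ->].
Qed.

Lemma inv_wordK : involutive inv_word.
Proof.
move=> w; rewrite /inv_word map_rev revK -map_comp -[RHS]map_id.
by apply: eq_map => a; exact: inv_letterK.
Qed.

Lemma inv_word_reduced w : freely_reduced w -> freely_reduced (inv_word w).
Proof.
rewrite /freely_reduced /inv_word rev_sorted sorted_map.
apply: sub_sorted => a b; apply: contra => /eqP/(can_inj inv_letterK) ->.
by rewrite inv_letterK.
Qed.

Lemma cat_reduceV w : cat_reduce (inv_word w) w = [::].
Proof.
elim: w => [//|a w IH].
by rewrite /inv_word /= rev_cons -cats1 /cat_reduce foldr_cat /= inv_letterK eqxx.
Qed.

Definition free_one : free_group n := @FreeGroup n [::] isT.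

Definition free_mul (x y : free_group n) : free_group n :=
  FreeGroup (cat_reduce_reduced (free_word x) (free_wordP y)).

Definition free_inv (x : free_group n) : free_group n :=
  FreeGroup (inv_word_reduced (free_wordP x)).

Lemma free_mulA : associative free_mul.
Proof. by move=> x y z; apply/val_inj/cat_reduceA/(free_wordP z). Qed.

Lemma free_mul1g : left_id free_one free_mul.
Proof. by move=> x; exact/val_inj. Qed.

Lemma free_mulg1 : right_id free_one free_mul.
Proof. by move=> x; apply/val_inj/cat_reduce0/(free_wordP x). Qed.

Lemma free_mulVg : left_inverse free_one free_inv free_mul.
Proof. by move=> x; apply/val_inj/cat_reduceV. Qed.

Lemma free_mulgV : right_inverse free_one free_inv free_mul.
Proof.
move=> x; apply/val_inj => /=.
by rewrite -{1}[free_word x]inv_wordK cat_reduceV.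
Qed.

End FreeGroup.

HB.instance Definition _ (n : nat) := isGroup.Build (free_group n)
  (@free_mulA n) (@free_mul1g n) (@free_mulg1 n) (@free_mulVg n) (@free_mulgV n).

Definition subgroup (G : groupType) (A : set G) : Prop :=
  A 1%g /\ forall x y : G, A x -> A y -> A (x / y)%g.

(* The elements of the external free product of the members of P: sequences of
   syllables (A, a) with 1 <> a \in A \in P, adjacent syllables lying in
   distinct factors. *)
Definition syllable_word (G : groupType) (P : set (set G)) (w : seq (set G * G)) :
    Prop :=
  (forall p, p \in w -> [/\ P p.1, p.1 p.2 & p.2 <> 1%g]) /\
  sorted (fun p q => p.1 != q.1) w.

(* H is the internal free product of the set P of subgroups: the natural map
   from the external free product of the members of P to H is a bijection. *)
Definition free_product (G : groupType) (H : set G) (P : set (set G)) : Prop :=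
  [/\ subgroup H,
      forall A, P A -> subgroup A /\ A `<=` H &
      forall h, H h ->
        exists! w, syllable_word P w /\ (\prod_(p <- w) p.2)%g = h].

(* Nontrivial free factors are automatically distinct, so an unordered free
   factorization A_1 * ... * A_k is faithfully encoded by {A_1, ..., A_k}. *)
Definition free_factorization (G : groupType) (k : nat) (P : set (set G)) : Prop :=
  [/\ (P #= `I_k)%card,
      forall A, P A -> A <> [set 1%g] &
      free_product [set: G] P].

Definition refines (G : groupType) (Q P : set (set G)) : Prop :=
  forall A, P A -> exists2 S, S `<=` Q & free_product A S.

Definition conj_class (G : groupType) (P : set (set G)) : set (set (set G)) :=
  [set Q | exists g : G, Q = [set [set (conjg x g)%g | x in A] | A in P]].

Definition es_vertices (n : nat) : set (set (set (set (free_group n)))) :=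
  [set c | exists2 P, free_factorization 2 P & c = conj_class P].

Definition es_vertex (n : nat) : choiceType := set_type (@es_vertices n).

Definition es_edge (n : nat) (c d : es_vertex n) : Prop :=
  c <> d /\
  exists P1 P2 Q : set (set (free_group n)),
    [/\ val c P1, val d P2, free_factorization 3 Q, refines Q P1 & refines Q P2].

(* The geometric realization of a graph, in barycentric coordinates. *)

Section MetricGraph.
Variables (R : realType) (V : eqType) (E : V -> V -> Prop).

Definition edge_point (u v : V) (t : R) : V -> R :=
  fun w => (1 - t) * (w == u)%:R + t * (w == v)%:R.

Definition realization : set (V -> R) :=
  [set p | exists u v t,
     [/\ u = v \/ E u v, 0 <= t <= 1 & p = edge_point u v t]].

Definition segment (p q : V -> R) (l : R) : Prop :=
  exists u v s t,
    [/\ E u v, 0 <= s <= 1 /\ 0 <= t <= 1,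
        p = edge_point u v s, q = edge_point u v t & l = `|s - t|].

Inductive polygonal_path : (V -> R) -> (V -> R) -> R -> Prop :=
| polygonal_nil p : polygonal_path p p 0
| polygonal_cons p q r l m :
    segment p q l -> polygonal_path q r m -> polygonal_path p r (l + m).

(* Path metric with edges of length 1; it is +oo between distinct components. *)
Definition path_metric (p q : realization) : \bar R :=
  ereal_inf [set l%:E | l in polygonal_path (val p) (val q)].

End MetricGraph.

Definition gromov_product (R : realType) (X : Type) (d : X -> X -> \bar R)
    (x y o : X) : R :=
  (fine (d x o) + fine (d y o) - fine (d x y)) / 2.

(* The finiteness conditions are vacuous when d is a genuine metric; for an
   extended metric they ask for a common constant on all the components. *)
Definition gromov_hyperbolic (R : realType) (X : Type) (d : X -> X -> \bar R) :
    Prop :=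
  exists2 delta : R, 0 <= delta &
    forall o x y z : X,
      (d x o < +oo)%E -> (d y o < +oo)%E -> (d z o < +oo)%E ->
      Num.min (gromov_product d x z o) (gromov_product d z y o) - delta
        <= gromov_product d x y o.

(* Main.v *)
Require Import Defs.
From mathcomp Require Import all_boot all_order all_algebra.
From mathcomp Require Import all_classical all_reals ereal.
From mathcomp Require Import zify ring lra.

(** Let t be a generator of the free group, A the subgroup generated by the
    others, and consider the vertices v_w = [A * <t w>] for w in A.  Changing t
    into r t s shows that d(v_w, v_w') is invariant under left and right
    translations by A, so for g, h in A the map (a, b) |-> v_(g^a h^b) is
    translation invariant on Z^2.  Take h to be the image of g under an
    automorphism of A and put F(a) = d(v_1, v_(g^a)) = d(v_1, v_(h^a)).  The
    four-point condition on the squares of vertices (0,0), (a,0), (0,a), (a,a) and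
    (0,0), (a,a), (a,-a), (2a,0), together with a linear lower bound for the
    distances d(v_1, v_(g^a h^a)) and d(v_(g^a), v_(h^a)), yields
    F(2a) <= 2 F(a) - kappa a + C, which is impossible for a nonnegative F.

    Lower bounds on the distance come from a Brooks quasimorphism psi on A
    counting a word u whose Whitehead graph has no cut vertex.  For a vertex
    [B * C], consider the subwords t alpha t, alpha in A, of the cyclically reduced
    conjugates of elements of B and C.  The values psi(alpha) all agree up to a
    constant: choose r, s in A for which the words s alpha r are shortest; if
    one of them contained u, the Whitehead graph of the resulting words would be
    connected without cut vertex, against Whitehead's lemma.  Whitehead's lemma
    itself holds because the first syllable of an element of B * C defines
    a clopen partition of the boundary of the Cayley tree that separates the ends of no
    axis of a conjugate of an element of B or C.  Adjacent vertices share the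
    elements of a common refinement, hence psi descends to a coarsely Lipschitz
    function on the graph, with value about psi(w) at v_w. *)

Set Implicit Arguments.
Unset Strict Implicit.
Unset Printing Implicit Defensive.
Import Order.TTheory GRing.Theory Num.Theory.

(** * Words and homomorphisms *)

Local Notation no_cancel := (fun a b => b != inv_letter a).

Definition cyc_reduced n (w : seq (letter n)) : bool := cycle no_cancel w.

Definition len n (g : free_group n) : nat := size (free_word g).
Arguments len {n} g%_group_scope.

Definition group_of_word n (w : seq (letter n)) : free_group n :=
  @FreeGroup n (cat_reduce w [::]) (@cat_reduce_reduced n w [::] isT).

Section Words.
Variable n : nat.
Implicit Types (a b : letter n) (u v w : seq (letter n)) (g h k : free_group n).
Local Open Scope group_scope.
Local Notation word := (@free_word n).
Local Notation gw := (@group_of_word n).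

Lemma inv_letter_neq a : inv_letter a != a.
Proof. by case: a => i []; rewrite /inv_letter xpair_eqE eqxx. Qed.

Lemma free_wordM g h : word (g * h) = cat_reduce (word g) (word h).
Proof. by []. Qed.

Lemma free_wordV g : word g^-1 = inv_word (word g).
Proof. by []. Qed.

Lemma word_inj : injective word. Proof. exact: val_inj. Qed.

Lemma cat_reduceE u v : freely_reduced (u ++ v) -> cat_reduce u v = u ++ v.
Proof.
elim: u => [//|a u IH] /= r.
rewrite IH; last exact: path_sorted r.
by case: (u ++ v) r => [//|b w] /= /andP[/negbTE ->].
Qed.

Lemma gw_word g : gw (word g) = g.
Proof. by apply: word_inj; rewrite /= cat_reduce0 ?free_wordP. Qed.

Lemma word_gw w : freely_reduced w -> word (gw w) = w.
Proof. exact: cat_reduce0. Qed.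

Lemma gw_cat u v : gw (u ++ v) = gw u * gw v.
Proof.
apply: word_inj; rewrite free_wordM /= -cat_reduceA ?cat_reduce_reduced //.
by rewrite /cat_reduce foldr_cat.
Qed.

Lemma gw_nil : gw [::] = 1. Proof. exact: word_inj. Qed.

Lemma gw_cons a w : gw (a :: w) = gw [:: a] * gw w.
Proof. by rewrite -cat1s gw_cat. Qed.

Lemma gw_rcons w a : gw (rcons w a) = gw w * gw [:: a].
Proof. by rewrite -cats1 gw_cat. Qed.

Lemma word_inv_cons a w : inv_word (a :: w) = rcons (inv_word w) (inv_letter a).
Proof. by rewrite /inv_word /= rev_cons. Qed.

Lemma inv_word_rcons w a : inv_word (rcons w a) = inv_letter a :: inv_word w.
Proof. by rewrite /inv_word map_rcons rev_rcons. Qed.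

Lemma inv_word_cat u v : inv_word (u ++ v) = inv_word v ++ inv_word u.
Proof. by rewrite /inv_word map_cat rev_cat. Qed.

Lemma size_inv_word w : size (inv_word w) = size w.
Proof. by rewrite size_rev size_map. Qed.

Lemma gw_inv1 a : gw [:: inv_letter a] = (gw [:: a])^-1.
Proof. exact: word_inj. Qed.

Lemma gw_inv w : gw (inv_word w) = (gw w)^-1.
Proof.
elim: w => [|a w IH]; first by rewrite gw_nil invg1.
by rewrite word_inv_cons gw_rcons IH (gw_cons a) invgM gw_inv1.
Qed.

Lemma size_cat_reduce u v : (size (cat_reduce u v) <= size u + size v)%N.
Proof.
elim: u => [//|a u IH] /=.
case: (cat_reduce u v) IH => [//|b w] /= IH; case: eqP => _ /=; lia.
Qed.

Lemma len1 : len (1 : free_group n) = 0%N. Proof. by []. Qed.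

Lemma len_eq0 g : (len g == 0%N) = (g == 1).
Proof.
by apply/eqP/eqP => [/size0nil gE|-> //]; apply: word_inj; rewrite gE.
Qed.

Lemma lenM g h : (len (g * h) <= len g + len h)%N.
Proof. exact: size_cat_reduce. Qed.

Lemma lenV g : len g^-1 = len g.
Proof. by rewrite /len free_wordV size_inv_word. Qed.

Lemma lenMr g h : (len g <= len (g * h) + len h)%N.
Proof. by have := lenM (g * h) h^-1; rewrite mulgK lenV. Qed.

Lemma len_gtMr M g h : (M + len h < len g)%N -> (M < len (g * h))%N.
Proof. by have := lenMr g h; lia. Qed.

Lemma len_gtM M g h : (M + len h < len (g * h))%N -> (M < len g)%N.
Proof. by have := lenM g h; lia. Qed.

Lemma len_gt_neq1 M g : (M < len g)%N -> g != 1.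
Proof. by rewrite -len_eq0; lia. Qed.

Lemma len_gw w : (len (gw w) <= size w)%N.
Proof. by have := size_cat_reduce w [::]; rewrite addn0. Qed.

Lemma reduced_infix u v w : freely_reduced (u ++ v ++ w) -> freely_reduced v.
Proof. by move/cat_sorted2 => [_ /cat_sorted2[]]. Qed.

(** The block [z] is everything that cancels in the product; it is peeled off at the junction one
    letter at a time. *)
Lemma cancellation u v : freely_reduced u -> freely_reduced v ->
  exists u' z v', [/\ u = u' ++ z, v = inv_word z ++ v' & freely_reduced (u' ++ v')].
Proof.
elim/last_ind: u v => [|u a IH] v ru rv; first by exists [::], [::], v.
have ru' : freely_reduced u by move: ru; rewrite -cats1 => /cat_sorted2[].
case: v rv => [|b v] rv; first by exists (rcons u a), [::], [::]; rewrite !cats0.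
have [bE|nb] := eqVneq b (inv_letter a).
  have [u' [z [v' [-> vE r]]]] := IH v ru' (path_sorted rv).
  exists u', (rcons z a), v'; split => //; first by rewrite rcons_cat.
  by rewrite inv_word_rcons bE vE.
exists (rcons u a), [::], (b :: v); split; rewrite ?cats0 //.
rewrite /freely_reduced sorted_cat_cons; apply/andP; split=> //.
case: u ru {ru' IH} => [|c u] /= ru; first by rewrite nb.
by rewrite rcons_path ru last_rcons.
Qed.

Lemma cyc_reducedP a w :
  cyc_reduced (a :: w) = freely_reduced (a :: w) && no_cancel (last a w) a.
Proof. by rewrite /cyc_reduced /= rcons_path. Qed.

Lemma cyc_reduced_reduced w : cyc_reduced w -> freely_reduced w.
Proof. by case: w => [//|a w]; rewrite cyc_reducedP => /andP[]. Qed.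

Lemma cyc_reduced_rot i w : cyc_reduced (rot i w) = cyc_reduced w.
Proof. exact: rot_cycle. Qed.

Lemma cyc_reduced_inv w : cyc_reduced w -> cyc_reduced (inv_word w).
Proof.
move=> cw; case: w cw => [//|a w] cw.
have [/(inv_word_reduced) rw lw] : freely_reduced (a :: w) /\ no_cancel (last a w) a.
  by apply/andP; rewrite -cyc_reducedP.
have := rw; rewrite word_inv_cons.
case/lastP: w lw {cw rw} => [|w b] lw rw.
  by rewrite cyc_reducedP /= inv_letterK inv_letter_neq.
rewrite inv_word_rcons /= in rw *.
rewrite rcons_path; apply/andP; split => //=.
by rewrite last_rcons inv_letterK eq_sym; move: lw; rewrite /= last_rcons.
Qed.

Lemma conj_cyc_reduced g : exists k, cyc_reduced (word (g ^ k)).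
Proof.
have [N] := ubnP (len g); elim: N g => // N IH g gN.
have [cg|] := boolP (cyc_reduced (word g)); first by exists 1; rewrite conjg1.
case gE: (word g) => [//|a w]; rewrite cyc_reducedP -gE free_wordP andTb negbK => /eqP aE.
have gaw : g = gw [:: a] * gw w by rewrite -gw_cons -gE gw_word.
have [w' wE] : exists w', w = rcons w' (inv_letter a).
  case/lastP: w aE {gE gaw} => [|w' b] /= aE.
    by have := inv_letter_neq a; rewrite -aE eqxx.
  by exists w'; move: aE; rewrite last_rcons => ->; rewrite inv_letterK.
have gJ : g ^ gw [:: a] = gw w'.
  by rewrite gaw wE gw_rcons gw_inv1 conjgE !mulgA mulVg mul1g mulgVK.
have [|k ck] := IH (g ^ gw [:: a]).
  rewrite gJ; apply: leq_ltn_trans (len_gw _) _.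
  by move: gN; rewrite /len gE wE /= size_rcons; lia.
by exists (gw [:: a] * k); rewrite conjgM.
Qed.

Lemma gwX w i : gw w ^+ i = gw (flatten (nseq i w)).
Proof.
by elim: i => [|i IH]; rewrite ?expg0 ?gw_nil // expgS IH -gw_cat.
Qed.

Lemma path_pow (R : rel (letter n)) a x s i : cycle R (x :: s) -> R a x ->
  path R a (flatten (nseq i (x :: s))).
Proof.
rewrite /= rcons_path => /andP[ps lx].
elim: i a => [//|i IH] a ax /=.
by rewrite ax cat_path ps /= IH.
Qed.

Lemma cyc_pow_reduced w i : cyc_reduced w -> freely_reduced (flatten (nseq i w)).
Proof.
case: w => [_|x s cw]; first by elim: i => [//|i IH].
case: i => [//|i]; have := cw; rewrite cyc_reducedP => /andP[rx lx].
by rewrite /freely_reduced /= cat_path; apply/andP; split; last exact: path_pow.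
Qed.

Lemma size_pow w i : size (flatten (nseq i w)) = (i * size w)%N.
Proof. by elim: i => [//|i IH] /=; rewrite size_cat IH mulSn. Qed.

Lemma len_cycX g i : cyc_reduced (word g) -> len (g ^+ i) = (i * len g)%N.
Proof.
by move=> cg; rewrite -[g in LHS]gw_word gwX /len word_gw ?cyc_pow_reduced ?size_pow.
Qed.

Lemma len_pow_unbounded g N : g != 1 -> exists i, (N < len (g ^+ i))%N.
Proof.
move=> g1; have [k ck] := conj_cyc_reduced g.
have l0 : (0 < len (g ^ k))%N by rewrite lt0n len_eq0 conjg_eq1.
(* A power of the cyclically reduced conjugate is at least as long as its exponent, and conjugating
   back by [k] loses at most [2 * len k]. *)
pose i := (N + 2 * len k).+1; exists i.
have: (i <= len ((g ^+ i) ^ k))%N by rewrite conjXg len_cycX // -[X in (X <= _)%N]muln1 leq_mul.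
have := lenM k^-1 (g ^+ i * k); have := lenM (g ^+ i) k.
rewrite -conjgE lenV; move: (len (g ^+ i)) (len (g ^+ i * k)) (len (g ^+ i ^ k)) => p q r.
rewrite /i; move: (len k) => l. lia.
Qed.

End Words.

Section Hom.
Variables (n : nat) (G : groupType).
Local Open Scope group_scope.

Definition eval_letter (f : 'I_n -> G) (a : letter n) : G :=
  if a.2 then (f a.1)^-1 else f a.1.

Definition lift_hom (f : 'I_n -> G) (g : free_group n) : G :=
  \prod_(a <- free_word g) eval_letter f a.

Lemma eval_inv_letter f a : eval_letter f (inv_letter a) = (eval_letter f a)^-1.
Proof. by case: a => i []; rewrite /eval_letter /= ?invgK. Qed.

Lemma prod_cat_reduce f (u v : seq (letter n)) :
  \prod_(a <- cat_reduce u v) eval_letter f a =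
  (\prod_(a <- u) eval_letter f a) * \prod_(a <- v) eval_letter f a.
Proof.
elim: u => [|a u IH] /=; first by rewrite big_nil mul1g.
rewrite big_cons -mulgA -IH.
case: (cat_reduce u v) => [|b w] /=; first by rewrite big_cons big_nil.
case: eqP => [->|_]; last by rewrite big_cons.
by rewrite big_cons eval_inv_letter mulVKg.
Qed.

Lemma lift_homM f : {morph lift_hom f : g h / g * h}.
Proof. by move=> g h; apply: prod_cat_reduce. Qed.

Lemma lift_hom_word f w : lift_hom f (group_of_word w) = \prod_(a <- w) eval_letter f a.
Proof. by rewrite /lift_hom prod_cat_reduce big_nil mulg1. Qed.

End Hom.

Definition gen n (i : 'I_n) : free_group n := group_of_word [:: (i, false)].

Section MorphTheory.
Variables (G H : groupType) (f : G -> H).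
Hypothesis fM : {morph f : g h / (g * h)%g}.
Local Open Scope group_scope.

Lemma morph1 : f 1 = 1.
Proof. by apply: (mulgI (f 1)); rewrite -fM !mulg1. Qed.

Lemma morphV : {morph f : g / g^-1}.
Proof. by move=> g; apply: (mulgI (f g)); rewrite -fM !mulgV morph1. Qed.

Lemma morphX i : {morph f : g / g ^+ i}.
Proof. by move=> g; elim: i => [|i IH]; rewrite ?morph1 // !expgS fM IH. Qed.

Lemma morphJ : {morph f : g h / g ^ h}.
Proof. by move=> g h; rewrite !conjgE !fM morphV. Qed.

Lemma morph_prod (I : Type) (s : seq I) (F : I -> G) :
  f (\prod_(i <- s) F i) = \prod_(i <- s) f (F i).
Proof. by elim: s => [|i s IH]; rewrite ?big_nil ?morph1 // !big_cons fM IH. Qed.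
End MorphTheory.

Section Hom2.
Variables (n : nat) (G : groupType).
Local Open Scope group_scope.

Lemma lift_hom_gen (f : 'I_n -> G) i : lift_hom f (gen i) = f i.
Proof. by rewrite lift_hom_word big_cons big_nil mulg1. Qed.

Lemma eq_hom (f1 f2 : free_group n -> G) :
  {morph f1 : g h / g * h} -> {morph f2 : g h / g * h} ->
  (forall i, f1 (gen i) = f2 (gen i)) -> f1 =1 f2.
Proof.
move=> M1 M2 E g; rewrite -[g]gw_word.
elim: (free_word g) => [|[i b] w IH]; first by rewrite gw_nil !morph1.
rewrite gw_cons M1 M2 IH; congr (_ * _).
case: b; last exact: E.
by rewrite -[(i, true)]/(inv_letter (i, false)) gw_inv1 !morphV // -/(gen i) E.
Qed.

End Hom2.

(** * Colourings of a free group and the cut vertex lemma *)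

Section Syllables.
Variables (G : groupType) (P : set (set G)).
Hypothesis sgP : forall A, P A -> subgroup A.
Local Open Scope group_scope.
Local Open Scope classical_set_scope.
Implicit Types (s : seq (set G * G)) (D : set G).

Lemma subgroupM (A : set G) x y : subgroup A -> A x -> A y -> A (x * y).
Proof.
move=> [A1 AV] Ax Ay; rewrite -[y]invgK; apply: (AV) => //.
by rewrite -[y^-1]mul1g; apply: AV.
Qed.

Lemma subgroupV (A : set G) x : subgroup A -> A x -> A x^-1.
Proof. by move=> [A1 AV] Ax; rewrite -[x^-1]mul1g; apply: AV. Qed.

Lemma subgroupX (A : set G) x i : subgroup A -> A x -> A (x ^+ i).
Proof.
move=> sA Ax; elim: i => [|i IH]; first by case: sA.
by rewrite expgS; apply: subgroupM.
Qed.

Lemma syllable_word_prefix s1 s2 : syllable_word P (s1 ++ s2) -> syllable_word P s1.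
Proof.
move=> [Ps /cat_sorted2[ss _]]; split => // p ps1.
by apply: Ps; rewrite mem_cat ps1.
Qed.

Lemma syllable_word_rcons s p : syllable_word P s ->
  P p.1 -> p.1 p.2 -> p.2 <> 1 -> (forall s0 q, s = rcons s0 q -> q.1 != p.1) ->
  syllable_word P (rcons s p).
Proof.
move=> [Ps ss] P1 P2 P3 sp; split.
  by move=> q; rewrite mem_rcons inE => /orP[/eqP -> | /Ps].
case/lastP: s ss {Ps} sp => [//|s q] ss /(_ _ _ erefl) qp.
rewrite -cats1 cat_rcons sorted_cat_cons ss /=.
by rewrite qp.
Qed.

(** Right multiplication by an element of a factor only touches the end of the word: the last
    syllable disappears, changes, or is followed by a new one. Hence the first factor persists as
    long as neither word is empty. *)
Lemma syllable_snoc s D y : syllable_word P s -> P D -> D y -> y <> 1 ->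
  exists s', [/\ syllable_word P s',
    \prod_(p <- s') p.2 = (\prod_(p <- s) p.2) * y,
    (forall p, p \in s' -> p.1 = D \/ p.1 \in map fst s) &
    s != [::] -> s' != [::] -> head D (map fst s') = head D (map fst s)].
Proof.
move=> Ps PD Dy y1; case/lastP: s Ps => [|s [E d]] Ps.
  exists [:: (D, y)]; split => //; last by move=> p; rewrite inE => /eqP ->; left.
    by split => // p; rewrite inE => /eqP ->.
  by rewrite big_cons !big_nil mulg1 mul1g.
have headr z : head D (map fst (rcons s (E, d))) = head D (map fst (rcons s (E, z))).
  by case: (s).
have [ED|nED] := eqVneq E D.
  subst E; have sP : syllable_word P s.
    by move: Ps; rewrite -cats1 => /syllable_word_prefix.
  have [PdD Dd _] := Ps.1 (D, d) ltac:(by rewrite mem_rcons mem_head).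
  have [dy1|dy1] := eqVneq (d * y) 1.
    exists s; split => //.
    - by rewrite -cats1 big_cat big_cons big_nil /= mulg1 -mulgA dy1 mulg1.
    - by move=> p ps; right; rewrite map_rcons mem_rcons inE map_f ?orbT.
    - by case: (s).
  exists (rcons s (D, d * y)); split.
  - apply: syllable_word_rcons => //=; first exact: (subgroupM (sgP PD)).
      exact/eqP.
    move=> s0 q sE; have := Ps.2; rewrite sE -cats1 cat_rcons sorted_cat_cons /=.
    by case/and3P.
  - by rewrite -!cats1 !big_cat !big_cons !big_nil /= !mulg1 mulgA.
  - move=> p; rewrite mem_rcons inE => /orP[/eqP ->|ps]; first by left.
    by right; rewrite map_rcons mem_rcons inE map_f ?orbT.
  - by [].
exists (rcons (rcons s (E, d)) (D, y)); split.
- apply: syllable_word_rcons => //= s0 q /rcons_inj[_ <-] /=; exact: nED.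
- by rewrite -cats1 big_cat big_cons big_nil /= mulg1.
- move=> p; rewrite mem_rcons inE => /orP[/eqP ->|ps]; first by left.
  by right; apply: map_f.
- by case: (s).
Qed.

End Syllables.

Section Colour.
Variables (G : groupType) (P : set (set G)).
Hypothesis fpP : free_product [set: G]%classic P.
Local Open Scope group_scope.
Local Open Scope classical_set_scope.

Lemma free_product_subgroup A : P A -> subgroup A.
Proof. by case: fpP => _ + _ => /[apply] -[]. Qed.

Definition syllables (h : G) : seq (set G * G) :=
  projT1 (cid (let: And3 _ _ e := fpP in e h I)).

Lemma syllablesP h :
  syllable_word P (syllables h) /\ \prod_(p <- syllables h) p.2 = h.
Proof. by rewrite /syllables; case: cid => s [[]]. Qed.

Lemma syllables_unique s : syllable_word P s ->
  syllables (\prod_(p <- s) p.2) = s.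
Proof.
by move=> Ps; rewrite /syllables; case: cid => s' [_] /=; apply.
Qed.

Lemma syllables1 : syllables 1 = [::].
Proof. by rewrite -(@syllables_unique [::]) ?big_nil //; split. Qed.

(** The colouring to which the cut vertex argument is applied. Right multiplication by an element of
    a factor preserves it unless it starts or ends at the identity, which gets the default
    [false]. *)
Definition first_factor (D : set G) (h : G) : bool :=
  if syllables h is p :: _ then p.1 == D else false.

Lemma first_factor_mulr D E h y : P E -> E y -> h != 1 -> h * y != 1 ->
  first_factor D (h * y) = first_factor D h.
Proof.
move=> PE Ey h1 hy1; have [->|/eqP y1] := eqVneq y 1; first by rewrite mulg1.
have [Ph hE] := syllablesP h.
have [s [Ps sE _ hd]] := syllable_snoc free_product_subgroup Ph PE Ey y1.
have sE' : syllables (h * y) = s by rewrite -(syllables_unique Ps) sE hE.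
have h0 : syllables h != [::] by apply: contraNneq h1 => s0; rewrite -hE s0 big_nil.
have hy0 : s != [::] by apply: contraNneq hy1 => s0; rewrite -hE -sE s0 big_nil.
have := hd h0 hy0; rewrite /first_factor sE'.
by case: (s) hy0 (syllables h) h0 => [//|p s'] _ [//|q s''] _ /= ->.
Qed.

Lemma syllables_alternating A B a b i : P A -> P B -> A != B -> A a -> B b ->
  a <> 1 -> b <> 1 ->
  syllables ((a * b) ^+ i) = flatten (nseq i [:: (A, a); (B, b)]).
Proof.
move=> PA PB AB Aa Bb a1 b1; set s := flatten _.
rewrite (_ : _ ^+ i = \prod_(p <- s) p.2).
  apply: syllables_unique; split.
    rewrite /s; elim: (i) => [//|j IH] p; rewrite /= !inE.
    by case/or3P => [/eqP ->|/eqP -> |/IH].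
  rewrite /s; elim: (i) => [//|j IH] /=; rewrite AB /=.
  by case: j IH => [//|j] /= ->; rewrite eq_sym AB.
rewrite /s; elim: (i) => [|j IH]; first by rewrite big_nil.
by rewrite expgS IH /= !big_cons mulgA.
Qed.

End Colour.

(** * Colourings that extend to the boundary of the tree *)

Section Coarse.
Variable n : nat.
Local Open Scope group_scope.
Implicit Types (c : free_group n -> bool) (g h k x y : free_group n).

(* c has finite coboundary: it extends continuously to the boundary of the tree. *)
Definition coarse c :=
  forall k, exists M, forall x, (M < len x)%N -> c (x * k) = c x.

(* The extension of c takes the same value at both ends of each translate of
   the axis of g. *)
Definition balanced c g :=
  forall h, exists M, forall i j, (M < len (h * g ^+ i))%N ->
    (M < len (h * g^-1 ^+ j))%N -> c (h * g ^+ i) = c (h * g^-1 ^+ j).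

Variable P : set (set (free_group n)).
Hypothesis fpP : free_product [set: free_group n]%classic P.

(** [k] is applied one syllable at a time. The bound accumulates the lengths of the syllables, so
    that no intermediate product is the identity. *)
Lemma coarse_first_factor D : coarse (first_factor fpP D).
Proof.
move=> k; have [[Pk _] <-] := syllablesP fpP k.
elim: (syllables fpP k) Pk => [_|p s IH Ps].
  by exists 0 => x _; rewrite big_nil mulg1.
have [|M HM] := IH; first by move=> q qs; apply: Ps; rewrite inE qs orbT.
have [P1 P2 P3] := Ps p (mem_head _ _).
exists (M + len p.2)%N => x xM; rewrite big_cons mulgA HM; last exact: len_gtMr.
apply: (first_factor_mulr _ _ P1) => //; first exact: len_gt_neq1 xM.
exact: len_gt_neq1 (len_gtMr xM).
Qed.

(** Up to the fixed right factor [k], which coarseness ignores, the two far points of the axis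
    differ by right multiplication by an element of [E]. *)
Lemma balanced_first_factor D E y k : P E -> E y ->
  balanced (first_factor fpP D) (y ^ k).
Proof.
move=> PE Ey h; have [M HM] := coarse_first_factor D k.
have sE := free_product_subgroup fpP PE.
have conjE z i : h * (z ^ k) ^+ i = h * k^-1 * z ^+ i * k.
  by rewrite -conjXg conjgE !mulgA.
exists (M + len k)%N => i j; rewrite -conjVg !conjE => xi xj.
have [Mi Mj] : (M < len (h * k^-1 * y ^+ i) /\ M < len (h * k^-1 * y^-1 ^+ j))%N.
  by split; apply: len_gtM; eassumption.
rewrite !HM //.
have -> : h * k^-1 * y^-1 ^+ j = h * k^-1 * y ^+ i * (y ^- i * y^-1 ^+ j).
  by rewrite !mulgA mulgK.
apply/esym/(first_factor_mulr _ _ PE).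
- apply: (subgroupM sE); first exact/(subgroupV sE)/(subgroupX _ sE).
  exact/(subgroupX _ sE)/(subgroupV sE).
- exact: len_gt_neq1 Mi.
- by rewrite !mulgA mulgK (len_gt_neq1 Mj).
Qed.

(** For nontrivial a in [A] and b in [B], the powers of ab start in [A], those of ba start in [B],
    and both have unbounded length. *)
Lemma first_factor_nonconstant A B M : P A -> P B -> A <> B ->
  A <> [set 1]%classic -> B <> [set 1]%classic ->
  exists x y, [/\ (M < len x)%N, (M < len y)%N &
    first_factor fpP A x != first_factor fpP A y].
Proof.
move=> PA PB /eqP AB A1 B1.
have ntr D : P D -> D <> [set 1]%classic -> exists2 d, D d & d <> 1.
  move=> PD D1; apply: contrapT => nd; apply: D1; apply/seteqP; split=> x /=.
    by move=> Dx; apply: contrapT => x1; apply: nd; exists x.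
  by move=> ->; case: (free_product_subgroup fpP PD).
have [a Aa a1] := ntr A PA A1; have [b Bb b1] := ntr B PB B1.
have nt E F e f : P E -> P F -> E != F -> E e -> F f -> e <> 1 -> f <> 1 -> e * f != 1.
  move=> PE PF EF Ee Ff e1 f1; apply/eqP => ef1.
  have := syllables_alternating fpP 1 PE PF EF Ee Ff e1 f1.
  by rewrite ef1 expg1 syllables1.
have [i iM] := len_pow_unbounded M (nt _ _ _ _ PA PB AB Aa Bb a1 b1).
rewrite eq_sym in AB.
have [j jM] := len_pow_unbounded M (nt _ _ _ _ PB PA AB Bb Aa b1 a1).
exists ((a * b) ^+ i), ((b * a) ^+ j); split=> //.
have BA := AB; rewrite eq_sym in AB.
rewrite /first_factor (syllables_alternating _ _ PA PB AB Aa Bb a1 b1).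
rewrite (syllables_alternating _ _ PB PA BA Bb Aa b1 a1).
case: i iM => [|i]; first by rewrite expg0.
case: j jM => [|j]; first by rewrite expg0.
by rewrite /= eqxx (negbTE BA).
Qed.

End Coarse.

(** Rotation brings every turn of a cyclic word to the junction of its last and first letters, so
    only that junction has to be examined. *)
Lemma cycle_from_rot (T : eqType) (R : rel T) (w : seq T) :
  (forall i b s, rot i w = b :: s -> R (last b s) b) -> cycle R w.
Proof.
case: w => [//|x s] rotR.
have sortP (t : seq T) : (forall s1 a b s2, t = s1 ++ a :: b :: s2 -> R a b) -> sorted R t.
  elim: t => [//|a [//|b t] IH] tR; rewrite /= (tR [::] a b t erefl) /=.
  by apply: IH => s1 c d s2 E; apply: (tR (a :: s1) c d s2); rewrite /= E.
apply: (sortP (x :: rcons s x)) => s1 a b; case/lastP => [|s2 y].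
  rewrite -(cat1s a) catA cats1 -rcons_cons => /rcons_inj[].
  rewrite cats1 => E <-; have := rotR 0 x s; rewrite rot0 => /(_ erefl).
  by rewrite -[last x s]/(last x (x :: s)) E last_rcons.
rewrite -!rcons_cons -rcons_cat => /rcons_inj[E _].
have := rotR (size (rcons s1 a)) b (s2 ++ rcons s1 a).
by rewrite last_cat last_rcons; apply; rewrite E -cat_rcons rot_size_cat.
Qed.

(** Consecutive letters a, b of a cyclic word give the edge of its Whitehead graph joining the
    inverse of a to b. If the relation holds at all turns, [kappa] is constant on the components of
    the graph with the vertex [y] removed. *)
Definition whitehead_rel n (kappa : letter n -> bool) (y a b : letter n) : bool :=
  (inv_letter a != y) && (b != y) ==> (kappa (inv_letter a) == kappa b).

(** * Whitehead's cut vertex lemma *)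

Section CutVertex.
Variables (n : nat) (c : free_group n -> bool) (W : set (free_group n)).
Hypothesis n1 : (1 < n)%N.
Hypothesis coarse_c : coarse c.
Hypothesis cyc_W : forall w, W w -> cyc_reduced (free_word w).
Hypothesis bal_W : forall w k, W w -> balanced c (w ^ k)%g.
Hypothesis rigid_W : forall kappa y,
  (forall w, W w -> cycle (whitehead_rel kappa y) (free_word w)) ->
  forall a b, a != y -> b != y -> kappa a = kappa b.
Local Open Scope group_scope.
Local Notation word := (@free_word n).
Local Notation gw := (@group_of_word n).

Let uniform_coarse : exists M, forall a x, (M < len x)%N -> c (x * gw [:: a]) = c x.
Proof.
have [f Hf] := choice (fun a : 'I_n * bool => coarse_c (gw [:: a])).
exists (\max_a f a) => a x xM; apply: Hf; apply: leq_ltn_trans xM.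
exact: (leq_bigmax (a : 'I_n * bool)).
Qed.

(** The reduced words extending that of [h] form a half-tree. Its short elements are left out
    because coarseness does not control their colours. *)
Let mono M h k := forall y, prefix (word h) (word y) -> (M < len y)%N -> c y = k.

Let mono_deep M h : (forall a x, (M < len x)%N -> c (x * gw [:: a]) = c x) ->
  (M < len h)%N -> mono M h (c h).
Proof.
move=> HM hM y /prefixP[s]; rewrite -[y]gw_word => yE _.
have {y yE} [-> r] : gw (word y) = gw (word h ++ s) /\ freely_reduced (word h ++ s).
  by move: yE; rewrite gw_word => <-; rewrite gw_word free_wordP.
elim/last_ind: s r => [|s a IH] r; first by rewrite cats0 gw_word.
have r' : freely_reduced (word h ++ s).
  by move: r; rewrite -cats1 catA => /cat_sorted2[].
rewrite -rcons_cat gw_rcons HM ?IH //.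
by apply: leq_trans hM _; rewrite /len word_gw // size_cat leq_addr.
Qed.

Let ray h b s i : cyc_reduced (b :: s) -> freely_reduced (rcons (word h) b) ->
  word (h * gw (b :: s) ^+ i.+1) = word h ++ flatten (nseq i.+1 (b :: s)).
Proof.
move=> cs rh; rewrite gwX free_wordM word_gw ?cyc_pow_reduced // cat_reduceE //.
rewrite /freely_reduced /= sorted_cat_cons; apply/andP; split=> //.
by have := cyc_pow_reduced i.+1 cs.
Qed.

(* At a vertex h whose children half-trees are all monochromatic, an axis turning
   at h forces two children to have the same colour. *)
Let mono_step M h y kappa : (forall a, a != y -> freely_reduced (rcons (word h) a)) ->
  (forall a, a != y -> mono M (gw (rcons (word h) a)) (kappa a)) ->
  forall a b, a != y -> b != y -> kappa a = kappa b.
Proof.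
move=> red_y mono_y; apply: rigid_W => w Ww; apply: cycle_from_rot => i b s wE.
apply/implyP => /andP[ay b_y]; apply/eqP.
have cs : cyc_reduced (b :: s) by rewrite -wE cyc_reduced_rot cyc_W.
have gE : gw (b :: s) = w ^ gw (take i (word w)).
  rewrite -wE /rot gw_cat; have := gw_cat (take i (word w)) (drop i (word w)).
  rewrite cat_take_drop gw_word; move: (gw _) (gw _) => u v ->.
  by rewrite conjgE -mulgA mulKg.
have [N HN] := bal_W (gw (take i (word w))) Ww h; rewrite -gE in HN.
(* The translate of the axis through [h] leaves it towards [b] in one direction and towards [a] in
   the other. *)
pose a := inv_letter (last b s).
have [s' sE] : exists s', inv_word (b :: s) = a :: s'.
  by rewrite lastI inv_word_rcons; exists (inv_word (belast b s)).
have cs' : cyc_reduced (a :: s') by rewrite -sE cyc_reduced_inv.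
have gE' : (gw (b :: s))^-1 = gw (a :: s') by rewrite -gw_inv sE.
pose j := (M + N).+1.
have big t d : cyc_reduced (d :: t) -> d != y ->
    (M + N < len (h * gw (d :: t) ^+ j))%N.
  move=> ct dy; rewrite /len ray ?red_y // size_cat size_pow /j /=; nia.
have pre t d : cyc_reduced (d :: t) -> d != y ->
    c (h * gw (d :: t) ^+ j) = kappa d.
  move=> ct dy; apply: (mono_y d dy); last exact: leq_ltn_trans (leq_addr _ _) (big t d ct dy).
  by rewrite word_gw ?red_y // ray ?red_y //= -cat_rcons prefix_prefix.
rewrite -(pre _ _ cs b_y) -(pre _ _ cs' ay) -gE'; apply/esym/HN.
  exact: leq_ltn_trans (leq_addl _ _) (big _ _ cs b_y).
by rewrite gE'; apply: leq_ltn_trans (leq_addl _ _) (big _ _ cs' ay).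
Qed.

(** Monochromatic colouring spreads from deep half-trees back to the root: at each vertex
    [mono_step] merges the colours of the children, the excluded letter [y] pointing to the
    parent. *)
Theorem whitehead_cut_vertex : exists M k, forall x, (M < len x)%N -> c x = k.
Proof.
have [M HM] := uniform_coarse.
pose kappa h a := `[< mono M (gw (rcons (word h) a)) true >].
have Hk h a : (exists k, mono M (gw (rcons (word h) a)) k) ->
    mono M (gw (rcons (word h) a)) (kappa h a).
  by move=> [k mk]; rewrite /kappa; case: asboolP => [//|]; case: k mk.
have split_child h y : prefix (word h) (word y) -> (len h < len y)%N ->
    exists a, prefix (rcons (word h) a) (word y) && freely_reduced (rcons (word h) a).
  move=> /prefixP[[|a s] yE] hy.
    by move: hy; rewrite /len yE cats0 ltnn.
  exists a; rewrite yE -cat_rcons prefix_prefix /=.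
  by have := free_wordP y; rewrite yE -cat_rcons => /cat_sorted2[].
have mono_all d h : h != 1 -> (M < len h + d)%N -> exists k, mono M h k.
  elim: d h => [|d IH] h h1 hd.
    by exists (c h); apply: mono_deep => //; rewrite -(addn0 (len h)).
  have [hM|hM] := ltnP M (len h); first by exists (c h); apply: mono_deep.
  case/lastP wE: (word h) => [|s z]; first by rewrite -len_eq0 /len wE in h1.
  have ra a : (a != inv_letter z) = freely_reduced (rcons (word h) a).
    have := free_wordP h; rewrite wE -(cats1 _ a) cat_rcons.
    by rewrite /freely_reduced sorted_cat_cons => -> /=; rewrite andbT.
  have mh a : a != inv_letter z -> mono M (gw (rcons (word h) a)) (kappa h a).
    rewrite ra => r; apply/Hk/IH.
      by rewrite -len_eq0 /len word_gw // size_rcons.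
    by rewrite /len word_gw // size_rcons; move: hd; rewrite /len; lia.
  exists (kappa h z) => y hy My.
  have [|a /andP[pa]] := split_child h y hy; first exact: leq_ltn_trans My.
  rewrite -ra => az; rewrite (mh a az) ?word_gw -?ra //.
  apply: (mono_step _ mh) => //; first by move=> b; rewrite ra.
  by rewrite eq_sym inv_letter_neq.
have r1 a : freely_reduced (rcons (word 1) a) by [].
have m1 a : mono M (gw (rcons (word 1) a)) (kappa 1 a).
  by apply/Hk/(mono_all M); rewrite -?len_eq0 /len word_gw //= add1n.
pose a0 : letter n := (Ordinal (ltnW n1), false).
exists M, (kappa 1 a0) => x xM.
have [|a /andP[pa _]] := split_child 1 x (prefix0s _).
  by rewrite len1; apply: leq_ltn_trans xM.
rewrite (m1 a x) ?word_gw //.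
(* The root has no parent, so the excluded letter is free to choose; this one differs from both [a]
   and [a0]. *)
pose y : letter n := (Ordinal n1, a != (Ordinal n1, true)).
apply: (@mono_step M 1 y) => [b _|b _||]; [exact: r1|exact: m1| |by []].
by rewrite /y; case: (eqVneq a (Ordinal n1, true)) => [->|].
Qed.

End CutVertex.

(** * Counting quasimorphisms and transvections *)

Section Counting.
Variable T : eqType.
Implicit Types (u w x y : seq T).

Fixpoint occ u w : nat :=
  if w is _ :: w' then prefix u w + occ u w' else 0.

Lemma occ_cons u a w : occ u (a :: w) = prefix u (a :: w) + occ u w.
Proof. by []. Qed.

Lemma occ_cat_ge u x y : occ u x + occ u y <= occ u (x ++ y).
Proof.
elim: x => [|a x IH] //; rewrite cat_cons !occ_cons -addnA leq_add //.
rewrite -cat_cons; case: (boolP (prefix u (a :: x))) => [/prefixP[z ->]|//].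
by rewrite -catA prefix_prefix.
Qed.

Lemma occ_cat_le u x y : occ u (x ++ y) <= occ u x + occ u y + size u.
Proof.
(* The occurrences missed on the right start in [x] and end in [y]. Bounding their number by a
   minimum is what makes the induction on [x] work. *)
suff: occ u (x ++ y) <= occ u x + occ u y + minn (size x) (size u) by lia.
elim: x => [|a x IH]; first by rewrite /= min0n addn0.
rewrite cat_cons !occ_cons.
have [us|su] := leqP (size u) (size (a :: x)).
  have -> : prefix u (a :: x ++ y) = prefix u (a :: x).
    by rewrite !prefixE -cat_cons takel_cat.
  by move: IH us; rewrite [size (a :: x)]/=; lia.
have := leq_b1 (prefix u (a :: x ++ y)).
move: IH su; rewrite [size (a :: x)]/=; lia.
Qed.

Lemma ltn_occ_prefix u x y : x != [::] -> prefix u (x ++ y) -> occ u y < occ u (x ++ y).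
Proof.
case: x => [//|a x] _; rewrite cat_cons occ_cons => ->; rewrite add1n ltnS.
by apply: leq_trans (occ_cat_ge _ _ _); apply: leq_addl.
Qed.

Lemma infix_occ u w : occ u w != 0 -> infix u w.
Proof.
elim: w => [//|a w IH]; rewrite occ_cons infix_consl.
by case: (prefix u _).
Qed.

Lemma occ_notin u w a : a \in u -> a \notin w -> occ u w = 0.
Proof.
move=> au aw; apply/eqP; apply: contraNT aw => /infix_occ /infixP[s [s' ->]].
by rewrite !mem_cat au orbT.
Qed.
End Counting.

Section Brooks.
Variables (n : nat) (u : seq (letter n)).
Local Open Scope group_scope.
Implicit Types (g h : free_group n) (w : seq (letter n)).

Let psiw w : int := ((occ u w)%:Z - (occ u (inv_word w))%:Z)%R.

Definition psi g : int := psiw (free_word g).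
Arguments psi g%_group_scope.

(** Concatenation creates between 0 and [size u] new occurrences of [u], and as many at most in the
    inverse word. The two excesses enter with opposite signs, so the bound is not doubled. *)
Let psiw_cat x y : (`|psiw (x ++ y) - psiw x - psiw y| <= (size u)%:Z)%R.
Proof.
have ge v w : occ u v + occ u w <= occ u (v ++ w) by exact: occ_cat_ge.
have le v w : occ u (v ++ w) <= occ u v + occ u w + size u by exact: occ_cat_le.
rewrite /psiw inv_word_cat; have := ge x y; have := le x y.
have := ge (inv_word y) (inv_word x); have := le (inv_word y) (inv_word x).
move: (size u) (occ u (x ++ y)) (occ u (inv_word y ++ _)) (occ u x) (occ u y).
move=> s p q p1 p2; move: (occ u (inv_word x)) (occ u (inv_word y)); lia.
Qed.

Let psiw_inv x : psiw (inv_word x) = (- psiw x)%R.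
Proof. by rewrite /psiw inv_wordK opprB. Qed.

(** After cancellation g = xz, h = z^-1 y and gh = xy, so three concatenations are compared; the
    values at z and z^-1 cancel by antisymmetry. *)
Lemma psiM g h : (`|psi (g * h) - psi g - psi h| <= (3 * size u)%:Z)%R.
Proof.
rewrite /psi free_wordM.
have [x [z [y [gE hE r]]]] := cancellation (free_wordP g) (free_wordP h).
have -> : cat_reduce (free_word g) (free_word h) = x ++ y.
  have rg := free_wordP g; have rh := free_wordP h; rewrite gE hE in rg rh *.
  rewrite -(word_gw rg) -(word_gw rh) -free_wordM !gw_cat gw_inv.
  by rewrite mulgA mulgK -gw_cat word_gw.
rewrite gE hE; have := psiw_cat x z; have := psiw_cat (inv_word z) y.
have := psiw_cat x y; rewrite psiw_inv; lia.
Qed.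

Lemma psi_free g : ~~ infix u (free_word g) -> ~~ infix u (free_word g^-1) ->
  psi g = 0%R.
Proof.
move=> gu gu'; rewrite /psi /psiw -free_wordV.
have -> : occ u (free_word g) = 0%N.
  by apply/eqP; apply: contraNT gu; apply: infix_occ.
by have -> : occ u (free_word g^-1) = 0%N
  by apply/eqP; apply: contraNT gu'; apply: infix_occ.
Qed.
End Brooks.

(** * Subgroups generated by part of the basis, and transvections *)

Section Support.
Variables (n : nat) (p : pred 'I_n).
Local Open Scope group_scope.
Implicit Types (g h : free_group n).

Definition supp g : bool := all (fun a : letter n => p a.1) (free_word g).

Lemma supp1 : supp 1. Proof. by []. Qed.

Lemma suppM g h : supp g -> supp h -> supp (g * h).
Proof.
rewrite /supp free_wordM => + ph; elim: (free_word g) => [//|a w IH] /= /andP[pa /IH].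
case: (cat_reduce w _) => [|b s] /=; first by rewrite pa.
by case: eqP => _ /andP[pb ps] /=; rewrite ?pa ?pb.
Qed.

Lemma suppV g : supp g^-1 = supp g.
Proof. by rewrite /supp free_wordV /inv_word all_rev all_map. Qed.

Lemma supp_gw w : all (fun a : letter n => p a.1) w -> supp (group_of_word w).
Proof.
elim: w => [//|a w IH] /= /andP[pa /IH pw]; rewrite gw_cons; apply: suppM => //.
by rewrite /supp /= pa.
Qed.

Lemma subgroup_supp : subgroup [set g | supp g]%classic.
Proof. by split => // g h pg ph; apply: suppM => //; rewrite /= suppV. Qed.

Lemma suppX g i : supp g -> supp (g ^+ i).
Proof. exact: (subgroupX i subgroup_supp). Qed.

Lemma eq_lift_supp (G : groupType) (f1 f2 : 'I_n -> G) g : supp g ->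
  (forall i, p i -> f1 i = f2 i) -> lift_hom f1 g = lift_hom f2 g.
Proof.
move=> pg E; apply: eq_big_seq => a ag.
by rewrite /eval_letter E //; move/allP: pg; apply.
Qed.

End Support.

Lemma lift_gen n (g : free_group n) : lift_hom (@gen n) g = g.
Proof. by apply: (@eq_hom _ _ _ id); [exact: lift_homM | by [] | exact: lift_hom_gen]. Qed.

Section Twist.
Variables (n : nat) (t : 'I_n).
Local Open Scope group_scope.
Implicit Types (g h r s : free_group n).

Definition avoids := supp (fun i => i != t).

Definition twist r s : free_group n -> free_group n :=
  lift_hom (fun i => if i == t then r * gen t * s else gen i).

Lemma twistM r s : {morph twist r s : g h / g * h}.
Proof. exact: lift_homM. Qed.

Lemma twist_avoids r s g : avoids g -> twist r s g = g.
Proof.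
move=> ag; rewrite -[RHS]lift_gen; apply: eq_lift_supp ag _ => i.
by move/negbTE->.
Qed.

Lemma twist_gen r s i : twist r s (gen i) = if i == t then r * gen t * s else gen i.
Proof. exact: lift_hom_gen. Qed.

Lemma twist_t r s : twist r s (gen t) = r * gen t * s.
Proof. by rewrite twist_gen eqxx. Qed.

(** The factors [r'] and [s'] of the inner twist avoid x_t, so the outer twist fixes them and they
    end up outermost. *)
Lemma twist_comp r s r' s' g : avoids r' -> avoids s' ->
  twist r s (twist r' s' g) = twist (r' * r) (s * s') g.
Proof.
move=> ar as'; apply: (@eq_hom _ _ (twist r s \o twist r' s')).
- by move=> x y /=; rewrite !twistM.
- exact: twistM.
move=> i /=; rewrite !twist_gen.
case: eqP => [_|/eqP it]; last by rewrite twist_gen (negbTE it).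
by rewrite !twistM (twist_avoids _ _ ar) (twist_avoids _ _ as') twist_t !mulgA.
Qed.

Lemma twist11 g : twist 1 1 g = g.
Proof.
apply: (@eq_hom _ _ _ id); [exact: twistM | by [] | move=> i].
by rewrite twist_gen mul1g mulg1; case: eqP => [->|].
Qed.

Lemma twistK r s : avoids r -> avoids s -> cancel (twist r s) (twist r^-1 s^-1).
Proof. by move=> ar as_ g; rewrite twist_comp // mulgV mulVg twist11. Qed.

Lemma twistVK r s : avoids r -> avoids s -> cancel (twist r^-1 s^-1) (twist r s).
Proof.
by move=> ar as_ g; rewrite twist_comp /avoids ?suppV // mulgV mulVg twist11.
Qed.

End Twist.

(** * Pulling colourings back along automorphisms *)

Section Transport.
Variables (n : nat) (f f' : free_group n -> free_group n).
Local Open Scope group_scope.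
Hypothesis fM : {morph f : g h / g * h}.
Hypothesis f'M : {morph f' : g h / g * h}.
Hypothesis fK : cancel f f'.
Hypothesis f'K : cancel f' f.

Lemma len_hom (F : free_group n -> free_group n) : {morph F : g h / g * h} ->
  exists L, forall g, (len (F g) <= L * len g)%N.
Proof.
move=> FM; pose L := (\max_(a : 'I_n * bool) len (F (group_of_word [:: a])))%N.
exists L => g; rewrite -{1}[g]gw_word /len.
elim: (free_word g) => [|a w IH]; first by rewrite gw_nil morph1.
rewrite gw_cons FM; apply: leq_trans (lenM _ _) _.
rewrite mulnS leq_add //.
exact: (leq_bigmax (a : 'I_n * bool)).
Qed.

(** The inverse automorphism is Lipschitz for word length, so long elements have long images. *)
Lemma proper_hom M : exists M', forall g, (M' < len g)%N -> (M < len (f g))%N.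
Proof.
have [L HL] := len_hom f'M; exists (L * M)%N => g gM.
have := leq_trans gM (leq_trans (eq_leq _) (HL (f g))); rewrite fK => /(_ erefl).
by rewrite ltn_mul2l => /andP[].
Qed.

Lemma coarse_comp c : coarse c -> coarse (c \o f).
Proof.
move=> Hc k; have [M HM] := Hc (f k); have [M' HM'] := proper_hom M.
by exists M' => x xM; rewrite /= fM HM // HM'.
Qed.

Lemma balanced_comp c g : balanced c (f g) -> balanced (c \o f) g.
Proof.
move=> Hc h; have [M HM] := Hc (f h); have [M' HM'] := proper_hom M.
exists M' => i j /HM' hi /HM' hj; move: hi hj.
by rewrite /= !fM !(morphX fM) (morphV fM); apply: HM.
Qed.

End Transport.

(** * Minimal gauges *)

Lemma ltn_sum_seq (T : eqType) (s : seq T) (F F' : T -> nat) p0 :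
  (forall p, p \in s -> F p <= F' p) -> p0 \in s -> F p0 < F' p0 ->
  \sum_(p <- s) F p < \sum_(p <- s) F' p.
Proof.
move=> le ps lt; rewrite (perm_big _ (perm_to_rem ps)) [ltnRHS](perm_big _ (perm_to_rem ps)).
rewrite /= !big_cons -addSn leq_add // big_seq [leqRHS]big_seq.
by apply: leq_sum => p /mem_rem; apply: le.
Qed.

(* A word u whose Whitehead graph on the letters avoiding x_t stays connected when
   a vertex is removed. *)
Definition rich n (t : 'I_n) (u : seq (letter n)) : Prop :=
  forall kappa y, sorted (whitehead_rel kappa y) u ->
  forall a b : letter n, a.1 != t -> b.1 != t -> a != y -> b != y -> kappa a = kappa b.

Lemma whitehead_rel_inv n kappa (y a b : letter n) :
  whitehead_rel kappa y (inv_letter b) (inv_letter a) = whitehead_rel kappa y a b.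
Proof. by rewrite /whitehead_rel inv_letterK andbC [X in _ ==> X]eq_sym. Qed.

Lemma sorted_inv_word n (R : rel (letter n)) w :
  (forall a b, R (inv_letter b) (inv_letter a) = R a b) ->
  sorted R (inv_word w) = sorted R w.
Proof.
by move=> Rinv; rewrite rev_sorted sorted_map; apply: eq_sorted => a b; apply: Rinv.
Qed.

Section Arcs.
Variables (n : nat) (t : 'I_n).
Local Open Scope group_scope.
Local Notation word := (@free_word n).
Local Notation gw := (@group_of_word n).

(* An arc (b, alpha, b') stands for the subword x_t^b alpha x_t^b' of a cyclic word,
   the signs being encoded by booleans as in letters. *)
Definition arc : Type := bool * free_group n * bool.
Implicit Types (D : seq arc) (p q : arc) (e : bool -> free_group n).

(** The closing sign of an arc is not written, since it is the opening sign of the next arc along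
    the cycle. *)
Definition arcs_word D : seq (letter n) :=
  flatten [seq (t, p.1.1) :: word p.1.2 | p <- D].

Lemma gw_arcs_cons p D :
  gw (arcs_word (p :: D)) = gw [:: (t, p.1.1)] * p.1.2 * gw (arcs_word D).
Proof.
rewrite -[arcs_word (p :: D)]/(((t, p.1.1) :: word p.1.2) ++ arcs_word D).
by rewrite gw_cat gw_cons gw_word.
Qed.

Definition arc_link p q : bool := p.2 == q.1.1.

(** With opposite signs and a trivial middle, the two letters at the ends of the arc would
    cancel. *)
Definition proper_arc p : bool :=
  avoids t p.1.2 && ((p.2 == ~~ p.1.1) ==> (p.1.2 != 1)).

Definition arc_turns (R : rel (letter n)) p : bool :=
  path R (t, p.1.1) (rcons (word p.1.2) (t, p.2)).

Lemma path_arcs R p D : path arc_link p D ->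
  path R (t, p.1.1) (rcons (word p.1.2 ++ arcs_word D) (t, (last p D).2)) =
  all (arc_turns R) (p :: D).
Proof.
elim: D p => [|q D IH] p; first by rewrite /= cats0 andbT.
move=> /andP[/eqP pq /IH IHq].
rewrite -[all _ (p :: q :: D)]/(arc_turns R p && all (arc_turns R) (q :: D)) -IHq.
rewrite /arcs_word /= -/(arcs_word D) -cat_rcons rcons_cat cat_path last_rcons.
by rewrite /arc_turns pq.
Qed.

Lemma cycle_arcs R D : cycle arc_link D ->
  cycle R (arcs_word D) = all (arc_turns R) D.
Proof.
case: D => [//|p D]; rewrite /= rcons_path => /andP[pD /eqP lp].
by have := path_arcs R pD; rewrite /= => <-; rewrite lp.
Qed.

Lemma proper_arc_turns p : proper_arc p -> arc_turns no_cancel p.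
Proof.
case: p => -[b g] b' /andP[/= ag pg]; rewrite /arc_turns /=.
have := free_wordP g; rewrite /avoids /supp in ag.
case wE: (word g) ag => [|a w] ag rg.
  rewrite /= andbT /inv_letter xpair_eqE eqxx /=.
  by apply: contraTN pg => ->; rewrite -len_eq0 /len wE.
have tE (d d' : letter n) : d.1 != t -> d'.1 == t -> no_cancel d d'.
  by move=> dt /eqP dt'; apply: contraNneq dt => E; rewrite -dt' E.
rewrite rcons_cons /= rcons_path; apply/and3P; split.
- apply: contraTneq ag => ->; by rewrite /= eqxx.
- exact: rg.
- by apply: tE => //; move/allP: ag; apply; apply: mem_last.
Qed.

Lemma cyc_reduced_arcs D : cycle arc_link D -> all proper_arc D ->
  cyc_reduced (arcs_word D).
Proof.
move=> cD /allP pD; rewrite /cyc_reduced cycle_arcs //.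
by apply/allP => p /pD /proper_arc_turns.
Qed.

(** This is the effect on arcs of replacing x_t by (e true)^-1 x_t (e false): [e false] is attached
    to the terminal end of x_t and [e true] to its initial end. *)
Definition gauge e p : arc := (p.1.1, e p.1.1 * p.1.2 * (e (~~ p.2))^-1, p.2).

Definition gauge_twist e := twist t (e true)^-1 (e false).

Lemma gauge_twist_t e b :
  gauge_twist e (gw [:: (t, b)]) = (e (~~ b))^-1 * gw [:: (t, b)] * e b.
Proof.
case: b; last exact: twist_t.
rewrite -[(t, true)]/(inv_letter (t, false)) gw_inv1 /gauge_twist.
by rewrite (morphV (twistM _ _ _)) twist_t !invgM invgK mulgA.
Qed.

Lemma gauge_twist_arcs e p D : path arc_link p D ->
  all proper_arc (p :: D) ->
  gauge_twist e (gw (arcs_word (p :: D))) =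
  (e (~~ p.1.1))^-1 * gw (arcs_word (map (gauge e) (p :: D))) * e (~~ (last p D).2).
Proof.
elim: D p => [|q D IH] p pD /andP[/andP[ap _] aD].
  rewrite [map _ _]/= !gw_arcs_cons [arcs_word [::]]/= gw_nil !mulg1 /gauge_twist twistM.
  rewrite (twist_avoids _ _ ap) -/(gauge_twist e) gauge_twist_t /gauge /=.
  by rewrite !mulgA mulgVK.
have /andP[/eqP pq qD] := pD.
rewrite [map _ _]/= gw_arcs_cons [in RHS]gw_arcs_cons.
rewrite /gauge_twist !twistM (twist_avoids _ _ ap) -/(gauge_twist e) IH //.
by rewrite gauge_twist_t [gauge e p]/gauge /= -pq !mulgA.
Qed.

(** An open chain of arcs retains one factor at each extremity. Closing the chain makes these two
    factors inverse to each other, so they amount to a conjugation. *)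
Lemma gauge_twist_cyc e D : cycle arc_link D -> all proper_arc D ->
  exists z, gauge_twist e (gw (arcs_word D)) = gw (arcs_word (map (gauge e) D)) ^ z.
Proof.
case: D => [|p D] cD aD.
  by exists 1; rewrite /arcs_word /= gw_nil conj1g /gauge_twist (morph1 (twistM _ _ _)).
move: cD; rewrite /= rcons_path => /andP[pD /eqP lp].
exists (e (~~ p.1.1)); rewrite gauge_twist_arcs // lp.
by rewrite conjgE mulgA.
Qed.

Lemma cycle_gauge e D : cycle arc_link (map (gauge e) D) = cycle arc_link D.
Proof. by rewrite cycle_map. Qed.

Lemma proper_gauge e p : (forall b, avoids t (e b)) -> proper_arc p ->
  proper_arc (gauge e p).
Proof.
move=> ae /andP[ap np]; apply/andP; split.
  rewrite /avoids /=; apply: suppM; last by rewrite suppV; apply: ae.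
  by apply: suppM => //; apply: ae.
apply/implyP => /= /eqP bE; move: np; rewrite bE eqxx negbK /=.
by rewrite -(conjg_eq1 _ (e p.1.1)^-1) conjgE invgK mulgA.
Qed.

Lemma gauge_gauge e e' p : gauge e' (gauge e p) = gauge (fun b => e' b * e b) p.
Proof. by rewrite /gauge /= invgM !mulgA. Qed.

Definition arcs_len D : nat := \sum_(p <- D) len p.1.2.

Lemma exists_min_gauge D : exists e, (forall b, avoids t (e b)) /\
  forall e', (forall b, avoids t (e' b)) ->
    arcs_len (map (gauge e) D) <= arcs_len (map (gauge e') D).
Proof.
pose Q k := `[< exists e, (forall b, avoids t (e b)) /\ arcs_len (map (gauge e) D) = k >].
have exQ : exists k, Q k.
  by exists (arcs_len (map (gauge (fun=> 1)) D)); apply/asboolP; exists (fun=> 1).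
have [k /asboolP[e [ae eE]] mink] := ex_minnP exQ.
exists e; split => // e' ae'; rewrite eE; apply: mink.
by apply/asboolP; exists e'.
Qed.

Definition rev_arc p : arc := (~~ p.2, p.1.2^-1, ~~ p.1.1).

Lemma rev_arc_turns R p : (forall a b, R (inv_letter b) (inv_letter a) = R a b) ->
  arc_turns R (rev_arc p) = arc_turns R p.
Proof.
move=> Rinv; rewrite /arc_turns.
rewrite -!/(sorted R (_ :: _)) -[RHS]sorted_inv_word //.
by rewrite word_inv_cons inv_word_rcons.
Qed.

Lemma len_strip y g w : word g = y :: w -> len ((gw [:: y])^-1 * g) < len g.
Proof.
move=> gE; rewrite -{1}[g]gw_word gE (gw_cons y w) mulKg [ltnRHS]/len gE /=.
exact: len_gw.
Qed.

Lemma len_strip_conj y g w v : word g = y :: w -> word g^-1 = y :: v ->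
  len ((gw [:: y])^-1 * g * gw [:: y]) < len g.
Proof.
move=> gE gVE.
have [w' wE] : exists w', w = rcons w' (inv_letter y).
  have := gE; rewrite -[g]invgK free_wordV gVE word_inv_cons.
  case/lastP: (w) => [|w' a].
    by case: (inv_word v) => [|? []] //= [/eqP]; rewrite (negbTE (inv_letter_neq _)).
  by rewrite -rcons_cons => /rcons_inj[_ <-]; exists w'.
rewrite -{1}[g]gw_word gE (gw_cons y w) mulKg wE gw_rcons gw_inv1 mulgVK.
by rewrite [ltnRHS]/len gE wE /= size_rcons ltnW // ltnS; apply: len_gw.
Qed.

Section MinimalGauge.
Variables (u : seq (letter n)) (D : seq arc) (beta : free_group n).
Hypothesis rich_u : rich t u.
Hypothesis u0 : u != [::].
Hypothesis properD : all proper_arc D.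
Hypothesis minD : forall e, (forall b, avoids t (e b)) ->
  arcs_len D <= arcs_len (map (gauge e) D).
Hypothesis betaD : (false, beta, false) \in D.
Hypothesis u_beta : infix u (word beta) || infix u (word beta^-1).

Variables (kappa : letter n -> bool) (y : letter n).
Let R := whitehead_rel kappa y.
Hypothesis turnsD : all (arc_turns R) D.

Let Rinv a b : R (inv_letter b) (inv_letter a) = R a b.
Proof. exact: whitehead_rel_inv. Qed.

Let beta1 : beta != 1.
Proof.
apply: contraTneq u_beta => ->; rewrite invg1 /= orbb.
by case: (u) u0.
Qed.

Let sorted_u : sorted R u.
Proof.
have sb : sorted R (word beta).
  have /allP/(_ _ betaD) := turnsD.
  by rewrite /arc_turns /= => /path_sorted; rewrite -cats1 => /cat_sorted2[].
case/orP: u_beta => /infix_sorted; apply => //.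
by rewrite free_wordV sorted_inv_word.
Qed.

(* If the Whitehead graph at a minimal gauge had the cut vertex y, then a colour
   class would consist of ends of x_t all of whose arcs start with y, and moving
   these ends across y would shorten the arcs. *)
Lemma minimal_gauge_rigid a b : a != y -> b != y -> kappa a = kappa b.
Proof.
have [i0 it] : exists i0, i0 != t.
  have /allP/(_ _ betaD)/andP[ab _] := properD.
  case wE: (word beta) => [|[i d] w]; first by have := beta1; rewrite -len_eq0 /len wE.
  by exists i; move: ab; rewrite /avoids /supp /= wE => /andP[].
(* The sign is chosen so that [a0] differs from [y]. *)
pose a0 : letter n := (i0, y == (i0, false)).
have a0y : a0 != y.
  by rewrite /a0; case: (eqVneq y (i0, false)) => [->|]; rewrite ?xpair_eqE ?andbF 1?eq_sym.
have KA d : d.1 != t -> d != y -> kappa d = kappa a0.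
  by move=> dt dy; apply: (rich_u sorted_u).
(* [Z d] marks an end of x_t whose colour differs from the common colour of the other letters. It is
   indexed by the sign [d] of the letter opening an arc there, whose inverse is the vertex of the
   Whitehead graph. *)
pose Z d := ((t, ~~ d) != y) && (kappa (t, ~~ d) != kappa a0).
have start p : avoids t p.1.2 -> arc_turns R p -> Z p.1.1 ->
    (exists w, word p.1.2 = y :: w) \/ p.1.2 = 1 /\ ((t, p.2) = y \/ Z (~~ p.2)).
  case: p => -[d g] d' /= ag; rewrite /arc_turns /= => + /andP[dy dk].
  case wE: (word g) => [|x w] /= /andP[Rx _].
    right; split; first by apply/eqP; rewrite -len_eq0 /len wE.
    have [->|d'y] := eqVneq (t, d') y; [by left | right].
    move: Rx; rewrite /R /whitehead_rel /Z negbK d'y.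
    by rewrite [inv_letter _]/= dy /= => /eqP <-.
  left; exists w; congr (_ :: _); apply/eqP; apply: contraNT dk => xy.
  have xt : x.1 != t by move: ag; rewrite /avoids /supp wE => /andP[].
  by move: Rx; rewrite /R /whitehead_rel xy dy /= => /eqP ->; rewrite KA.
have turns p : p \in D -> [/\ avoids t p.1.2, arc_turns R p,
    avoids t (rev_arc p).1.2 & arc_turns R (rev_arc p)].
  move=> pD; have /allP/(_ _ pD)/andP[ap _] := properD.
  have /allP/(_ _ pD) tp := turnsD.
  by split => //; rewrite ?rev_arc_turns // /avoids /= suppV.
have [as_ ts ar tr] := turns _ betaD.
have bV1 : beta^-1 != 1 by rewrite invg_eq1.
(* The far end of [beta] is treated by reversing the arc. As [beta] is nontrivial, [start] leaves
   only the case of a word beginning with [y], so [y] avoids x_t as soon as some end is marked. *)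
have Zbeta d : Z d ->
    exists w, word (if d then beta^-1 else beta) = y :: w.
  case: d => Zd.
    by have [//|[/= b1]] := start _ ar tr Zd; rewrite b1 eqxx in bV1.
  by have [//|[/= b1]] := start _ as_ ts Zd; have := beta1; rewrite b1 eqxx.
have yt d : Z d -> y.1 != t.
  move=> /Zbeta[w].
  have : avoids t (if d then beta^-1 else beta) by case: (d).
  by rewrite /avoids /supp => + wE; rewrite wE => /andP[].
have noZ : forall d, Z d = false.
  apply: contrapT => exZ.
  have [d0 Zd0] : exists d, Z d.
    by apply: contrapT => nZ; apply: exZ => d; apply/negP => Zd; apply: nZ; exists d.
  have tyN d : (t, d) <> y by move=> E; have := yt _ Zd0; rewrite -E eqxx.
  (* This gauge strips [y] from the arcs at the marked ends. *)
  pose e d := if Z d then (gw [:: y])^-1 else 1.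
  have ae d : avoids t (e d).
    rewrite /e; case: ifP => _; last exact: supp1.
    by rewrite /avoids suppV; apply: supp_gw; rewrite /= (yt _ Zd0).
  have end_ g : len (g * gw [:: y]) = len ((gw [:: y])^-1 * g^-1).
    by rewrite -lenV invgM.
  (* A nontrivial arc with a marked end gets shorter. A trivial arc has both ends marked or none,
     since [y] is not a letter x_t, and there the two factors cancel. *)
  have shrink p : p \in D -> len (gauge e p).1.2 <= len p.1.2 ?= iff
      ((p.1.2 == 1) || ~~ (Z p.1.1 || Z (~~ p.2))).
    move=> /turns[ap tp ap' tp']; have st := start _ ap tp; have en := start _ ap' tp'.
    case: p ap tp ap' tp' st en => -[d g] d' /= ap tp ap' tp' st en.
    apply/leqifP; rewrite /e negbK in en *.
    case Zd: (Z d) st en => st en; case Zd': (Z (~~ d')) en => en /=; rewrite ?orbT ?orbF /=.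
    - case: eqP => [->|g1]; first by rewrite mulg1 invgK mulVg.
      have [[w wE]|[]//] := st isT; rewrite invgK.
      have [[v vE]|[/eqP]] := en isT; first exact: len_strip_conj wE vE.
      by rewrite invg_eq1 => /eqP.
    - have [[w wE]|[_ [/tyN//|]]] := st isT; last by rewrite Zd'.
      case: eqP => [g1|_]; first by rewrite g1 in wE.
      by rewrite invg1 mulg1; apply: len_strip wE.
    - have [[w wE]|[_ [/tyN//|]]] := en isT; last by [].
      case: eqP => [g1|_]; first by move: wE; rewrite /= g1.
      rewrite mul1g invgK end_ -[ltnRHS]lenV.
      by move: wE; rewrite -free_wordV => /len_strip.
    - by rewrite mul1g invg1 mulg1.
  have := minD ae; rewrite leqNgt => /negP; apply.
  rewrite /arcs_len big_map; apply: (ltn_sum_seq (p0 := (false, beta, false))) => //.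
    by move=> p /shrink[].
  rewrite (ltn_leqif (shrink _ betaD)) /= (negbTE beta1) /=.
  by case: d0 Zd0 => ->; rewrite ?orbT.
have all_k d : d != y -> kappa d = kappa a0.
  case: d => i d; have [->|it'] := eqVneq i t; last exact: KA.
  by move=> dy; have := noZ (~~ d); rewrite /Z negbK dy /= => /negbFE/eqP.
by move=> ay b_y; rewrite !all_k.
Qed.

End MinimalGauge.

End Arcs.

(** * Pieces *)

Section Pieces.
Variables (n : nat) (t : 'I_n).
Local Open Scope group_scope.
Local Notation word := (@free_word n).
Local Notation gw := (@group_of_word n).
Implicit Types (g h w alpha : free_group n).

Definition piece_word alpha w : Prop :=
  [/\ cyc_reduced (word w), avoids t alpha &
      exists s, word w = (t, false) :: word alpha ++ (t, false) :: s].

(** The final sign [e] can be prescribed because [arcs_word] does not record it; for a cyclic word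
    it is set to the sign of the opening letter. *)
Lemma parse_arcs s b e : freely_reduced s -> exists p D,
  [/\ arcs_word t (p :: D) = (t, b) :: s, p.1.1 = b, path (@arc_link n) p D,
      (last p D).2 = e & all (fun p => avoids t p.1.2) (p :: D)].
Proof.
elim: s b => [|a s IH] b rs; first by exists (b, 1, e), [::].
have rs' : freely_reduced s := path_sorted rs.
have [aE|at_] := eqVneq a.1 t.
  have [p [D [pE p1 pD pl pa]]] := IH a.2 rs'.
  exists (b, 1, a.2), (p :: D); split => //.
    2: by apply/andP; split => //; rewrite /arc_link p1.
  rewrite -[LHS]/((t, b) :: arcs_word t (p :: D)) pE.
  by rewrite -aE -surjective_pairing.
have [[[b0 g] b1] [D [pE /= p1 pD pl /andP[ga pa]]]] := IH b rs'.
have sE : s = word g ++ arcs_word t D by case: pE.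
have rg : freely_reduced (a :: word g).
  by have := rs; rewrite sE -cat_cons => /cat_sorted2[].
exists (b0, gw (a :: word g), b1), D; split => //.
- rewrite -[LHS]/(((t, b0) :: word (gw (a :: word g))) ++ arcs_word t D) word_gw //.
  by rewrite p1 sE.
- by case: (D) pD.
- by case: (D) pl.
- by apply/andP; split => //; apply: supp_gw; rewrite /= at_.
Qed.

Lemma piece_arcs alpha w : piece_word alpha w -> exists D,
  [/\ cycle (@arc_link n) D, all (proper_arc t) D, (false, alpha, false) \in D &
      arcs_word t D = word w].
Proof.
move=> [cw aa [s wE]].
have rs : freely_reduced s.
  have := free_wordP w; rewrite wE -cat_cons -cat_rcons => /cat_sorted2[_].
  by [].
have [p [D [pE p1 pD pl pa]]] := parse_arcs false false rs.
pose D' := (false, alpha, false) :: p :: D.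
have DE : arcs_word t D' = word w.
  by rewrite wE -pE.
have cD : cycle (@arc_link n) D'.
  by rewrite /= rcons_path /arc_link p1 /= pD pl.
exists D'; split => //; last exact: mem_head.
have := cw; rewrite -DE /cyc_reduced cycle_arcs // => /allP turns.
apply/allP => q qD; rewrite /proper_arc; apply/andP; split.
  by move: qD; rewrite inE => /orP[/eqP -> //|qD]; move/allP: pa; apply.
have := turns q qD; rewrite /arc_turns.
case: q {qD} => -[d g] d' /=; apply: contraTT; rewrite negb_imply negbK.
by case/andP => /eqP -> /eqP ->; rewrite /= eqxx.
Qed.

Variable u : seq (letter n).
Hypothesis rich_u : rich t u.
Hypothesis u0 : u != [::].
Hypothesis n1 : (1 < n)%N.

Variables (P : set (set (free_group n))) (A B : set (free_group n)).
Hypothesis fpP : free_product [set: free_group n]%classic P.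
Hypotheses (PA : P A) (PB : P B) (AB : A <> B).
Hypotheses (A1 : A <> [set 1]%classic) (B1 : B <> [set 1]%classic).

Let pattern w := exists E y k, [/\ P E, E y & w = y ^ k].

(** The gauge is minimal for both lists of arcs together. If [u] occurred in a gauged piece or its
    inverse, the gauged words would satisfy the rigidity needed for [whitehead_cut_vertex], and the
    pulled back first-factor colouring would be constant far away, which it is not. *)
Lemma common_gauge alpha1 alpha2 w1 w2 :
  pattern w1 -> pattern w2 -> piece_word alpha1 w1 -> piece_word alpha2 w2 ->
  exists r s, psi u (s * alpha1 * r) = 0%R /\ psi u (s * alpha2 * r) = 0%R.
Proof.
move=> pw1 pw2 /piece_arcs[D1 [c1 p1 a1 E1]] /piece_arcs[D2 [c2 p2 a2 E2]].
have [e [ae mine]] := exists_min_gauge t (D1 ++ D2).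
exists (e true)^-1, (e false).
pose F := map (gauge e) (D1 ++ D2).
have pF : all (proper_arc t) F.
  apply/allP => _ /mapP[p pD ->]; apply: proper_gauge => //.
  by move: pD; rewrite mem_cat => /orP[]; move: p; apply/allP.
have minF e' : (forall b, avoids t (e' b)) -> arcs_len F <= arcs_len (map (gauge e') F).
  move=> ae'; rewrite /F -map_comp (eq_map (gauge_gauge e e')).
  by apply: mine => b; apply: suppM; [apply: ae' | apply: ae].
have inF alpha : (false, alpha, false) \in D1 ++ D2 ->
    (false, e false * alpha * (e true)^-1, false) \in F.
  by move=> aD; apply/mapP; exists (false, alpha, false).
suff H alpha : (false, alpha, false) \in D1 ++ D2 ->
    ~~ (infix u (word (e false * alpha * (e true)^-1)) ||
        infix u (word (e false * alpha * (e true)^-1)^-1)).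
  have /norP[? ?] := H alpha1 ltac:(by rewrite mem_cat a1).
  have /norP[? ?] := H alpha2 ltac:(by rewrite mem_cat a2 orbT).
  by split; apply: psi_free.
move=> /inF aF; apply/negP => uF.
pose W : set (free_group n) := [set gw (arcs_word t (map (gauge e) D1));
                                gw (arcs_word t (map (gauge e) D2))]%classic.
have cF D : cycle (@arc_link n) D -> all (proper_arc t) D ->
    cyc_reduced (arcs_word t (map (gauge e) D)).
  move=> cD pD; apply: cyc_reduced_arcs; first by rewrite cycle_gauge.
  by apply/allP => _ /mapP[p pp ->]; apply: proper_gauge => //; move/allP: pD; apply.
have wordF D : cycle (@arc_link n) D -> all (proper_arc t) D ->
    word (gw (arcs_word t (map (gauge e) D))) = arcs_word t (map (gauge e) D).
  by move=> cD pD; rewrite word_gw // cyc_reduced_reduced // cF.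
pose r := (e true)^-1; pose s := e false.
have ar : avoids t r by rewrite /avoids suppV; apply: ae.
have as_ : avoids t s := ae false.
(* [f'] is the gauge twist. Its inverse [f] sends the gauged words back to conjugates of elements of
   the factors, for which the colouring is balanced. *)
pose f := twist t r^-1 s^-1; pose f' := twist t r s.
have fM : {morph f : g h / g * h} by exact: twistM.
have f'M : {morph f' : g h / g * h} by exact: twistM.
have fK : cancel f f' by exact: twistVK.
have f'K : cancel f' f by exact: twistK.
pose c := first_factor fpP A.
have balF D w : cycle (@arc_link n) D -> all (proper_arc t) D -> pattern w ->
    arcs_word t D = word w -> forall k, balanced (c \o f) (gw (arcs_word t (map (gauge e) D)) ^ k).
  move=> cD pD [E [y [k0 [PE Ey wE]]]] DE k; apply: (balanced_comp fM f'M fK).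
  have [z] := gauge_twist_cyc e cD pD.
  rewrite DE gw_word /gauge_twist -/r -/s -/f' => /(congr1 f).
  rewrite f'K (morphJ fM) => /esym/(canRL (conjgK _)) /= zE.
  rewrite (morphJ fM) zE wE -!conjgM; exact: (balanced_first_factor fpP A _ PE Ey).
have [||||M [k Hk]] := @whitehead_cut_vertex n (c \o f) W n1.
- exact: (coarse_comp fM f'M fK (coarse_first_factor fpP A)).
- by move=> w [] ->; rewrite wordF // cF.
- by move=> w k [] ->; [apply: (balF _ _ c1 p1 pw1 E1) | apply: (balF _ _ c2 p2 pw2 E2)].
- move=> kappa y cW; apply: (minimal_gauge_rigid rich_u u0 pF minF aF uF).
  rewrite /F map_cat all_cat; apply/andP.
  by split; rewrite -cycle_arcs ?cycle_gauge // -wordF //; apply: cW; [left | right].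
have [M' HM'] := proper_hom fM f'K M.
have [x [y [xM yM]]] := first_factor_nonconstant fpP M' PA PB AB A1 B1.
have := Hk _ (HM' _ xM); have := Hk _ (HM' _ yM); rewrite /= !f'K /c => -> ->.
by rewrite eqxx.
Qed.

(** Each of the two triple products costs two defects of [3 * size u], and the values of psi at [r]
    and [s] drop out of the difference. *)
Lemma psi_pieces alpha1 alpha2 w1 w2 :
  pattern w1 -> pattern w2 -> piece_word alpha1 w1 -> piece_word alpha2 w2 ->
  (`|psi u alpha1 - psi u alpha2| <= (12 * size u)%:Z)%R.
Proof.
move=> p1 p2 q1 q2; have [r [s [E1 E2]]] := common_gauge p1 p2 q1 q2.
have := psiM u (s * alpha1) r; have := psiM u (s * alpha2) r.
have := psiM u s alpha1; have := psiM u s alpha2; rewrite E1 E2.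
move: (psi u r) (psi u s) (psi u alpha1) (psi u alpha2).
move: (psi u (s * alpha1)) (psi u (s * alpha2)); lia.
Qed.

End Pieces.

(** * Exponent sums and the existence of pieces *)

Section ExponentSum.
Variables (n : nat) (t : 'I_n).
Local Open Scope group_scope.
Local Notation word := (@free_word n).
Local Notation gw := (@group_of_word n).
Implicit Types (g h : free_group n).

Definition letter_sign (a : letter n) : int :=
  (if a.1 == t then if a.2 then -1 else 1 else 0)%R.

Let wsum (w : seq (letter n)) : int := (\sum_(a <- w) letter_sign a)%R.

Definition exp_sum g : int := wsum (word g).
Arguments exp_sum g%_group_scope.

Let sign_inv a : letter_sign (inv_letter a) = (- letter_sign a)%R.
Proof. by case: a => i []; rewrite /letter_sign /=; case: eqP. Qed.

Let wsum_reduce x y : wsum (cat_reduce x y) = (wsum x + wsum y)%R.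
Proof.
rewrite /wsum; elim: x => [|a x IH] /=; first by rewrite big_nil add0r.
rewrite big_cons -addrA -IH; case: (cat_reduce x y) => [|b s] /=.
  by rewrite big_cons.
case: eqP => [->|_]; last by rewrite big_cons.
by rewrite big_cons sign_inv addNKr.
Qed.

Lemma exp_sumM g h : exp_sum (g * h) = (exp_sum g + exp_sum h)%R.
Proof. exact: wsum_reduce. Qed.

Lemma exp_sum1 : exp_sum 1 = 0%R.
Proof. by rewrite /exp_sum /wsum big_nil. Qed.

Lemma exp_sumV g : exp_sum g^-1 = (- exp_sum g)%R.
Proof. by apply/eqP; rewrite -addr_eq0 -exp_sumM mulVg exp_sum1. Qed.

Lemma exp_sumJ g h : exp_sum (g ^ h) = exp_sum g.
Proof. by rewrite conjgE !exp_sumM exp_sumV; ring. Qed.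

Lemma exp_sum_gen : exp_sum (gen t) = 1%R.
Proof. by rewrite /exp_sum /wsum /= big_cons big_nil /letter_sign eqxx. Qed.

Let consecutive (w : seq (letter n)) : (2 <= wsum w)%R ->
  exists s1 a s2, w = s1 ++ (t, false) :: a ++ (t, false) :: s2 /\
    all (fun x : letter n => x.1 != t) a.
Proof.
(* Strengthened for induction from the left: without two such letters the sum is at most 0, or at
   most 1 with x_t first occurring positively. *)
have: (exists s1 a s2, w = s1 ++ (t, false) :: a ++ (t, false) :: s2 /\
        all (fun x : letter n => x.1 != t) a) \/ (wsum w <= 0)%R \/
      (wsum w <= 1)%R /\ exists a s2, w = a ++ (t, false) :: s2 /\
        all (fun x : letter n => x.1 != t) a.
  elim: w => [|a w IH]; first by right; left; rewrite /wsum big_nil.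
  have wE : wsum (a :: w) = (letter_sign a + wsum w)%R by rewrite /wsum big_cons.
  case: IH => [[s1 [b [s2 [-> ab]]]]|]; first by left; exists (a :: s1), b, s2.
  have [at_|at_] := eqVneq a.1 t.
    case: a at_ wE => i b /= ->; rewrite /letter_sign /= eqxx.
    case: b => wE; rewrite wE; case=> [w0|[w1 [b [s2 [E ab]]]]].
    - by right; left; lia.
    - by right; left; lia.
    - by right; right; split; [lia | exists [::], w].
    - by left; exists [::], b, s2; rewrite E.
  rewrite wE /letter_sign (negbTE at_) add0r.
  case=> [w0|[w1 [b [s2 [E ab]]]]]; first by right; left.
  right; right; split => //; exists (a :: b), s2; rewrite E; split => //=.
  by rewrite at_.
by case=> [//|[|[]]]; lia.
Qed.

(** Up to inversion the exponent sum is positive. Squaring makes it at least 2, which forces two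
    letters x_t with neither x_t nor its inverse in between; rotation then brings them to the
    front. *)
Lemma exists_piece g : exp_sum g != 0%R ->
  exists alpha h k, (h = g \/ h = g^-1) /\ piece_word t alpha ((h ^+ 2) ^ k).
Proof.
move=> g0; have [k ck] := conj_cyc_reduced g.
have [h [hg ch h0]] : exists h, [/\ h = g \/ h = g^-1, cyc_reduced (word (h ^ k)) &
    (1 <= exp_sum h)%R].
  have [g1|g1] := lerP 1%R (exp_sum g); first by exists g; split => //; left.
  exists g^-1; split; [by right | | by rewrite exp_sumV; move: g0 g1; lia].
  by rewrite conjVg free_wordV cyc_reduced_inv.
pose w := word (h ^ k).
have cww : cyc_reduced (w ++ w).
  move: ch; rewrite -/w; case: (w) => [//|x s]; rewrite /cyc_reduced /=.
  by rewrite rcons_path => /andP[ps lx]; rewrite rcons_cat cat_path ps /= lx rcons_path ps.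
have ww : (2 <= wsum (w ++ w))%R.
  rewrite /wsum big_cat -/(wsum w) -/(exp_sum (h ^ k)) exp_sumJ; exact: (lerD h0 h0).
have [s1 [a [s2 [wE aa]]]] := consecutive ww.
have hwE : gw (w ++ w) = (h ^+ 2) ^ k by rewrite gw_cat gw_word conjXg.
pose v := (t, false) :: a ++ (t, false) :: s2.
have vE : w ++ w = s1 ++ v by [].
have cv : cyc_reduced (v ++ s1).
  by have := cyc_reduced_rot (size s1) (w ++ w); rewrite cww vE rot_size_cat.
have ra : freely_reduced a.
  have := cyc_reduced_reduced cww.
  rewrite wE -[_ :: a ++ _]/([:: (t, false)] ++ a ++ _) catA.
  exact: reduced_infix.
exists (gw a), h, (k * gw s1); split => //.
have -> : (h ^+ 2) ^ (k * gw s1) = gw (v ++ s1).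
  by rewrite conjgM -hwE vE !gw_cat conjgE -mulgA mulKg.
rewrite /piece_word (word_gw (cyc_reduced_reduced cv)) (word_gw ra); split => //.
  exact: supp_gw.
by exists (s2 ++ s1); rewrite /v /= -catA.
Qed.

End ExponentSum.
Arguments exp_sum {n} t g%_group_scope.

(** * The action of automorphisms on the edge splitting graph *)

Section Images.
Local Open Scope group_scope.
Local Open Scope classical_set_scope.

Definition im2 (G : groupType) (f : G -> G) (P : set (set G)) : set (set G) :=
  [set [set f x | x in A] | A in P].

Lemma im2_comp (G : groupType) (f g : G -> G) P : im2 f (im2 g P) = im2 (f \o g) P.
Proof.
by rewrite /im2 image_comp; congr image; apply/funext => A /=; rewrite image_comp.
Qed.

Lemma im2_id (G : groupType) (f : G -> G) P :
  (forall A x, P A -> A x -> f x = x) -> im2 f P = P.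
Proof.
move=> fid.
have imA A : P A -> f @` A = A.
  move=> PA; apply/seteqP; split => x /=; first by move=> [z Az <-]; rewrite (fid A).
  by move=> Ax; exists x => //; apply: fid PA Ax.
apply/seteqP; split => A /=; first by move=> [B PB <-]; rewrite imA.
by move=> PA; exists A => //; apply: imA.
Qed.

Lemma eq_im2 (G : groupType) (f g : G -> G) P : f =1 g -> im2 f P = im2 g P.
Proof. by move=> /funext ->. Qed.

Lemma imageK (T U : Type) (f : T -> U) (f' : U -> T) (A : set T) : cancel f f' ->
  f' @` (f @` A) = A.
Proof.
move=> fK; rewrite image_comp; apply/seteqP; split => x /=.
  by move=> [z Az <-]; rewrite fK.
by move=> Ax; exists x => //; rewrite fK.
Qed.

Section Transported.
Variables (G : groupType) (f f' : G -> G).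
Hypothesis fM : {morph f : x y / x * y}.
Hypothesis f'M : {morph f' : x y / x * y}.
Hypothesis fK : cancel f f'.
Hypothesis f'K : cancel f' f.

Lemma im2K P : im2 f' (im2 f P) = P.
Proof. by rewrite im2_comp im2_id // => A x _ _ /=; rewrite fK. Qed.

Lemma subgroup_image (A : set G) : subgroup A -> subgroup (f @` A).
Proof.
move=> [A1 AV]; split; first by exists 1 => //; apply: morph1.
move=> _ _ [x Ax <-] [y Ay <-]; exists (x / y); first exact: AV.
by rewrite fM (morphV fM).
Qed.

Definition map_syllable (p : set G * G) : set G * G := (f @` p.1, f p.2).

Lemma syllable_word_image P s : syllable_word P s ->
  syllable_word (im2 f P) (map map_syllable s).
Proof.
move=> [Ps ss]; split.
  move=> _ /mapP[p /Ps[P1 P2 P3] ->] /=; split; first by exists p.1.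
    by exists p.2.
  by move=> /(congr1 f'); rewrite fK (morph1 f'M).
rewrite sorted_map; apply: sub_sorted ss => p q; apply: contra => /eqP /=.
by move=> /(congr1 (image^~ f')); rewrite !(imageK _ fK) => ->.
Qed.

End Transported.

Lemma map_syllableK (G : groupType) (f f' : G -> G) : cancel f f' ->
  cancel (map_syllable f) (map_syllable f').
Proof.
move=> fK [A x]; rewrite /map_syllable /= fK; congr pair; exact: imageK.
Qed.

Section Transported2.
Variables (G : groupType) (f f' : G -> G).
Hypothesis fM : {morph f : x y / x * y}.
Hypothesis f'M : {morph f' : x y / x * y}.
Hypothesis fK : cancel f f'.
Hypothesis f'K : cancel f' f.

Lemma free_product_image H P : free_product H P -> free_product (f @` H) (im2 f P).
Proof.
move=> [sH sP uP]; split; first exact: subgroup_image.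
  move=> _ [A PA <-]; have [sA AH] := sP A PA; split; first exact: subgroup_image.
  exact: image_subset.
move=> _ [x Hx <-]; have [s [[Ps sE] su]] := uP x Hx.
exists (map (map_syllable f) s); split.
  split; first exact: (syllable_word_image f'M fK).
  by rewrite big_map /= -sE (morph_prod fM).
move=> s' [Ps' sE'].
rewrite (su (map (map_syllable f') s')).
  by rewrite mapK //; apply: map_syllableK.
split; last by rewrite big_map /= -(morph_prod f'M) sE' fK.
by have := syllable_word_image fM f'K Ps'; rewrite (im2K fK).
Qed.

Lemma free_factorization_image k P :
  free_factorization k P -> free_factorization k (im2 f P).
Proof.
move=> [cP nP fP]; split.
- apply: card_eq_trans cP; apply: inj_card_eq => A B _ _.
  by move=> /(congr1 (image^~ f')); rewrite !(imageK _ fK).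
- move=> _ [A PA <-] /(congr1 (image^~ f')).
  by rewrite (imageK _ fK) image_set1 (morph1 f'M); apply: nP.
- have := free_product_image fP; rewrite (_ : f @` [set: G] = [set: G]) //.
  by apply/seteqP; split => // x _; exists (f' x).
Qed.

Lemma refines_image Q P : refines Q P -> refines (im2 f Q) (im2 f P).
Proof.
move=> QP _ [A PA <-]; have [S SQ fS] := QP A PA.
exists (im2 f S); last exact: free_product_image.
exact: image_subset.
Qed.

Lemma conj_class_image P : conj_class (im2 f P) = im2 f @` conj_class P.
Proof.
apply/seteqP; split => Q /=.
  move=> [g ->]; exists (im2 (conjg^~ (f' g)) P); first by exists (f' g).
  rewrite -[RHS]/(im2 (conjg^~ g) (im2 f P)) !im2_comp; apply: eq_im2 => x /=.
  by rewrite (morphJ fM) f'K.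
move=> [_ [g ->] <-]; exists (f g).
rewrite -[RHS]/(im2 (conjg^~ (f g)) (im2 f P)) -[X in im2 f X]/(im2 (conjg^~ g) P).
by rewrite !im2_comp; apply: eq_im2 => x /=; rewrite (morphJ fM).
Qed.

End Transported2.

Lemma conj_classE (G : groupType) (P Q : set (set G)) :
  conj_class P Q <-> exists g, Q = im2 (conjg^~ g) P.
Proof. by []. Qed.

Lemma im2_conjM (G : groupType) (P : set (set G)) g h :
  im2 (conjg^~ h) (im2 (conjg^~ g) P) = im2 (conjg^~ (g * h)) P.
Proof. by rewrite im2_comp; apply: eq_im2 => x /=; rewrite conjgM. Qed.

Lemma conj_class_conj (G : groupType) (P : set (set G)) g :
  conj_class (im2 (conjg^~ g) P) = conj_class P.
Proof.
apply/seteqP; split => _ /conj_classE[h ->]; apply/conj_classE.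
  by exists (g * h); rewrite im2_conjM.
by exists (g^-1 * h); rewrite im2_conjM mulVKg.
Qed.

Lemma conj_class_refl (G : groupType) (P : set (set G)) : conj_class P P.
Proof. by exists 1; rewrite -/(im2 _ _) im2_id // => A x _ _; rewrite conjg1. Qed.

Lemma free_factorization_conj (G : groupType) k (P Q : set (set G)) :
  free_factorization k P -> conj_class P Q -> free_factorization k Q.
Proof.
move=> fP /conj_classE[g ->]; apply: (free_factorization_image (f' := conjg^~ g^-1) _ _ _ _ fP).
- by move=> x y; exact: conjMg.
- by move=> x y; exact: conjMg.
- exact: conjgK.
- exact: conjgKV.
Qed.

End Images.

Section Vertices.
Variable n : nat.
Local Open Scope group_scope.
Local Open Scope classical_set_scope.
Local Notation F := (free_group n).

Record automorphism : Type := Automorphism {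
  aut_fun :> F -> F;
  aut_inv : F -> F;
  autM : {morph aut_fun : x y / x * y};
  aut_invM : {morph aut_inv : x y / x * y};
  autK : cancel aut_fun aut_inv;
  autVK : cancel aut_inv aut_fun
}.

Definition inv_aut (f : automorphism) : automorphism :=
  Automorphism (aut_invM f) (autM f) (autVK f) (autK f).

Definition comp_aut (f g : automorphism) : automorphism.
Proof.
apply: (@Automorphism (f \o g) (aut_inv g \o aut_inv f)).
- by move=> x y /=; rewrite !autM.
- by move=> x y /=; rewrite !aut_invM.
- by apply: can_comp; apply: autK.
- by apply: can_comp; apply: autVK.
Defined.

Lemma act_subproof (f : automorphism) (v : es_vertex n) : im2 f @` val v \in @es_vertices n.
Proof.
apply/mem_set; have := set_valP v; case=> P fP ->; exists (im2 f P).
  exact: (free_factorization_image (autM f) (aut_invM f) (autK f) (autVK f)).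
by rewrite (conj_class_image (autM f) (autVK f)).
Qed.

Definition act (f : automorphism) (v : es_vertex n) : es_vertex n :=
  SigSub (act_subproof f v).

Lemma val_act f v : val (act f v) = im2 f @` val v. Proof. by []. Qed.

Lemma act_id (f : automorphism) v : (forall x, f x = x) -> act f v = v.
Proof.
move=> fid; apply/val_inj; rewrite val_act; apply/seteqP; split => P /=.
  by move=> [Q vQ <-]; rewrite im2_id.
by move=> vP; exists P => //; apply: im2_id.
Qed.

Lemma act_comp (f g h : automorphism) v : (forall x, f (g x) = h x) ->
  act f (act g v) = act h v.
Proof.
move=> fgh; apply/val_inj; rewrite !val_act image_comp; congr image.
by apply/funext => P /=; rewrite im2_comp; apply: eq_im2.
Qed.

Lemma actK f : cancel (act f) (act (inv_aut f)).
Proof.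
move=> v; apply/val_inj; rewrite !val_act; apply: imageK => P.
exact: (im2K (autK f)).
Qed.

Lemma act_edge f v w : es_edge v w -> es_edge (act f v) (act f w).
Proof.
move=> [vw [P1 [P2 [Q [v1 w2 fQ r1 r2]]]]]; split.
  by move=> /(congr1 (act (inv_aut f))); rewrite !actK.
exists (im2 f P1), (im2 f P2), (im2 f Q); split.
- by exists P1.
- by exists P2.
- exact: (free_factorization_image (autM f) (aut_invM f) (autK f) (autVK f)).
- exact: (refines_image (autM f) (aut_invM f) (autK f) (autVK f)).
- exact: (refines_image (autM f) (aut_invM f) (autK f) (autVK f)).
Qed.

Lemma vertex_factorization (v : es_vertex n) P : val v P -> free_factorization 2 P.
Proof.
by have := set_valP v; case=> P0 fP0 -> vP; apply: free_factorization_conj vP.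
Qed.

Lemma vertex_conj (v : es_vertex n) P Q : val v P -> val v Q -> conj_class P Q.
Proof.
have := set_valP v; case=> P0 _ -> /conj_classE[g ->] /conj_classE[h ->].
by apply/conj_classE; exists (g^-1 * h); rewrite im2_conjM mulVKg.
Qed.

Lemma conj_vertex (v : es_vertex n) P Q : val v P -> conj_class P Q -> val v Q.
Proof.
have := set_valP v; case=> P0 _ -> /conj_classE[g ->] /conj_classE[h ->].
by apply/conj_classE; exists (g * h); rewrite im2_conjM.
Qed.

End Vertices.

(** * Normal forms and refinements of free factorizations *)

Section Refinement.
Variables (G : groupType).
Local Open Scope group_scope.
Local Open Scope classical_set_scope.

(** The syllables are appended one by one with [syllable_snoc]. The last clause, that no new factor
    appears, is what [refines_member] relies on. *)
Lemma syllable_normal_form (Q : set (set G)) (l : seq (set G * G)) :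
  (forall A, Q A -> subgroup A) ->
  (forall p, p \in l -> Q p.1 /\ p.1 p.2) ->
  exists s, [/\ syllable_word Q s, \prod_(p <- s) p.2 = \prod_(p <- l) p.2 &
    forall p, p \in s -> p.1 \in map fst l].
Proof.
move=> sQ; elim/last_ind: l => [|l [D y] IH] Ql.
  by exists [::]; split => //; split.
have [|s [Qs sE sl]] := IH; first by move=> p pl; apply: Ql; rewrite mem_rcons inE pl orbT.
have [/= QD Dy] := Ql (D, y) ltac:(by rewrite mem_rcons mem_head).
have [->|/eqP y1] := eqVneq y 1.
  exists s; split => //; first by rewrite -cats1 big_cat big_cons big_nil /= !mulg1 sE.
  by move=> p /sl; rewrite map_rcons mem_rcons inE => ->; rewrite orbT.
have [s' [Qs' sE' s's _]] := syllable_snoc sQ Qs QD Dy y1.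
exists s'; split => //; first by rewrite sE' sE -cats1 big_cat big_cons big_nil /= mulg1.
move=> p /s's; rewrite map_rcons mem_rcons inE => -[->|/mapP[q /sl ql ->]].
  by rewrite eqxx.
by rewrite ql orbT.
Qed.

(** Otherwise [D] would be absent from the decomposition of every member of [P]. A nontrivial d in
    [D] would then be a product of elements of other factors, contradicting its one-syllable normal
    form. *)
Lemma refines_member (Q P : set (set G)) D :
  free_product [set: G] Q -> free_product [set: G] P -> refines Q P ->
  Q D -> D <> [set 1] -> exists2 A, P A & D `<=` A.
Proof.
move=> fQ fP QP QD D1; apply: contrapT => nA.
have sQ := free_product_subgroup fQ.
have [d Dd d1] : exists2 d, D d & d <> 1.
  apply: contrapT => nd; apply: D1; apply/seteqP; split=> x /=.
    by move=> Dx; apply: contrapT => x1; apply: nd; exists x.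
  by move=> ->; case: (sQ _ QD).
have gen A x : P A -> A x -> exists l : seq (set G * G),
    (forall p, p \in l -> [/\ Q p.1, p.1 p.2 & p.1 <> D]) /\ \prod_(p <- l) p.2 = x.
  move=> PA Ax; have [S SQ [_ SA /(_ x Ax)[l [[[Sl _] lE] _]]]] := QP A PA.
  exists l; split => // p /Sl[Sp pp _]; split => //; first exact: SQ.
  by move=> pD; apply: nA; exists A => //; rewrite -pD; case: (SA _ Sp).
have [[Ps _] sE] := syllablesP fP d.
have [l [Ql lE]] : exists l : seq (set G * G),
    (forall p, p \in l -> [/\ Q p.1, p.1 p.2 & p.1 <> D]) /\ \prod_(p <- l) p.2 = d.
  rewrite -sE; elim: (syllables fP d) Ps => [_|p s IH Ps].
    by exists [::]; rewrite !big_nil.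
  have [|l [Ql lE]] := IH; first by move=> q qs; apply: Ps; rewrite inE qs orbT.
  have [P1 P2 _] := Ps p (mem_head _ _).
  have [l' [Ql' lE']] := gen _ _ P1 P2.
  exists (l' ++ l); split; last by rewrite big_cat big_cons /= lE' lE.
  by move=> q; rewrite mem_cat => /orP[/Ql'|/Ql].
have [|s [Qs sE' sl]] := syllable_normal_form (l := l) sQ.
  by move=> p /Ql[].
have := syllables_unique fQ Qs; rewrite sE' lE.
have Dw : syllable_word Q [:: (D, d)] by split => // p; rewrite inE => /eqP ->.
have := syllables_unique fQ Dw; rewrite big_cons big_nil /= mulg1 => -> sD.
have /mapP[p /Ql[_ _ pD] Dp] : D \in map fst l by apply: (sl (D, d)); rewrite -sD mem_head.
by apply: pD.
Qed.

Lemma two_factors k (P : set (set G)) : free_factorization k.+2 P ->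
  exists A B, [/\ P A, P B, A <> B, A <> [set 1] & B <> [set 1]].
Proof.
move=> [cP nP _]; have := card_esym cP; rewrite card_eq_le => /andP[/pcard_leP[f] _].
have P0 : P (f 0%N) by apply: funS.
have P1 : P (f 1%N) by apply: funS.
exists (f 0%N), (f 1%N); split => //; try exact: nP.
move=> E; have m0 : 0%N \in `I_k.+2 by apply/mem_set.
have m1 : 1%N \in `I_k.+2 by apply/mem_set.
by have := inj m0 m1 E.
Qed.

End Refinement.

(** * A Lipschitz function on the vertices *)

Section VertexPieces.
Variables (n : nat) (t : 'I_n) (u : seq (letter n)).
Hypothesis rich_u : rich t u.
Hypothesis u0 : u != [::].
Hypothesis n1 : (1 < n)%N.
Local Open Scope group_scope.
Local Open Scope classical_set_scope.
Implicit Types (v w : es_vertex n).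

Definition piece v alpha : Prop := exists P E x,
  [/\ val v P, P E, E x & piece_word t alpha x].

(** Representatives of one vertex are conjugate, so both words are conjugate into factors of the
    same factorization and [psi_pieces] applies. *)
Lemma piece_bound v alpha beta : piece v alpha -> piece v beta ->
  (`|psi u alpha - psi u beta| <= (12 * size u)%:Z)%R.
Proof.
move=> [P [E [x [vP PE Ex ax]]]] [Q [F [y [vQ QF Fy b_y]]]].
have fP := vertex_factorization vP.
have [A [B [PA PB AB A1 B1]]] := two_factors fP; case: fP => _ _ fP.
have /conj_classE[g QE] := vertex_conj vP vQ.
have [F0 PF0 FE] : exists2 F0, P F0 & [set conjg x g | x in F0] = F.
  by move: QF; rewrite QE => -[F0 PF0 <-]; exists F0.
have [y0 F0y yE] : exists2 y0, F0 y0 & y0 ^ g = y by move: Fy; rewrite -FE => -[y0]; exists y0.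
apply: (psi_pieces rich_u u0 n1 fP PA PB AB A1 B1 _ _ ax b_y).
  by exists E, x, 1; rewrite conjg1.
by exists F0, y0, g.
Qed.

(** The factors of the common refinement generate x_t, so one of them has an element of nonzero
    exponent sum and yields a piece. That factor lies in a factor of each of the two vertices. *)
Lemma edge_common_piece v w : es_edge v w -> exists alpha, piece v alpha /\ piece w alpha.
Proof.
move=> [_ [P1 [P2 [Q [vP1 wP2 [_ nQ fQ] r1 r2]]]]].
have [_ _ fP1] := vertex_factorization vP1; have [_ _ fP2] := vertex_factorization wP2.
have [D [q [QD Dq q0]]] : exists D q, [/\ Q D, D q & exp_sum t q != 0%R].
  apply: contrapT => nq.
  have [[Ps _] sE] := syllablesP fQ (gen t).
  have : exp_sum t (gen t) = 0%R.
    rewrite -sE; elim: (syllables fQ _) Ps => [_|p s IH Ps].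
      by rewrite big_nil exp_sum1.
    rewrite big_cons exp_sumM IH; last by move=> r rs; apply: Ps; rewrite inE rs orbT.
    rewrite addr0; apply/eqP; apply: contraT => p0; case: nq.
    by have [Qp pp _] := Ps p (mem_head _ _); exists p.1, p.2.
  by rewrite exp_sum_gen.
have [alpha [h [k [hq pw]]]] := exists_piece q0.
have sD := free_product_subgroup fQ QD.
have Dh : D (h ^+ 2).
  by apply: subgroupX => //; case: hq => ->; [|apply: subgroupV].
have [A1 PA1 DA1] := refines_member fQ fP1 r1 QD (nQ _ QD).
have [A2 PA2 DA2] := refines_member fQ fP2 r2 QD (nQ _ QD).
exists alpha; split.
- exists (im2 (conjg^~ k) P1), [set conjg x k | x in A1], ((h ^+ 2) ^ k); split=> //.
  + by apply: conj_vertex vP1 _; exists k.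
  + by exists A1.
  + by exists (h ^+ 2) => //; apply: DA1.
- exists (im2 (conjg^~ k) P2), [set conjg x k | x in A2], ((h ^+ 2) ^ k); split=> //.
  + by apply: conj_vertex wP2 _; exists k.
  + by exists A2.
  + by exists (h ^+ 2) => //; apply: DA2.
Qed.

(** The choice of the piece matters only up to [12 * size u]; 0 is the default in the absence of
    pieces. *)
Definition vertex_psi v : int :=
  if pselect (exists alpha, piece v alpha) is left e then psi u (projT1 (cid e)) else 0%R.

Lemma vertex_psi_piece v alpha : piece v alpha ->
  (`|vertex_psi v - psi u alpha| <= (12 * size u)%:Z)%R.
Proof.
rewrite /vertex_psi; case: pselect => [e|ne pa]; last by case: ne; exists alpha.
exact: piece_bound (projT2 (cid e)).
Qed.

Lemma vertex_psi_edge v w : es_edge v w ->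
  (`|vertex_psi v - vertex_psi w| <= (24 * size u)%:Z)%R.
Proof.
move=> /edge_common_piece[alpha [/vertex_psi_piece + /vertex_psi_piece]].
move: (vertex_psi v) (vertex_psi w) (psi u alpha); lia.
Qed.

End VertexPieces.

(** * Standard free factorizations *)

Section Standard.
Variables (n : nat) (K : finType) (f : 'I_n -> K).
Local Open Scope group_scope.
Local Open Scope classical_set_scope.
Local Notation F := (free_group n).
Local Notation word := (@free_word n).

(** The map [f] labels the basis by [K], so that coarsening a factorization amounts to composing [f]
    with a map of labels. *)
Definition standard_factor (J : pred K) : set F := [set g | supp (fun i => J (f i)) g].

Definition standard_factors (J : pred K) : set (set F) :=
  [set standard_factor (pred1 j) | j in [set j | J j]].

Lemma standard_factor_sub J J' : {subset J <= J'} ->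
  standard_factor J `<=` standard_factor J'.
Proof. by move=> sJ g; apply: sub_all => a; apply: sJ. Qed.

Lemma standard_factor_letter (J : pred K) a : J (f a.1) ->
  standard_factor J (group_of_word [:: a]).
Proof. by move=> Ja; rewrite /standard_factor /= /supp /= Ja. Qed.

(** Adjacent syllables involve disjoint sets of generators, so nothing cancels at their
    junctions. *)
Let word_syllables s : syllable_word (standard_factors predT) s ->
  word (\prod_(p <- s) p.2) = flatten [seq word p.2 | p <- s].
Proof.
elim: s => [_|p s IH [Ps ss]]; first by rewrite big_nil.
have {}IH : word (\prod_(p <- s) p.2) = flatten [seq word p.2 | p <- s].
  apply: IH; split; last exact: path_sorted ss.
  by move=> q qs; apply: Ps; rewrite inE qs orbT.
rewrite big_cons free_wordM IH /= cat_reduceE //.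
case: s ss Ps IH => [|q s] /= ss Ps IH; first by rewrite cats0 free_wordP.
have [[j _ jE] pj p1] := Ps p (mem_head _ _).
have [[k _ kE] qk q1] := Ps q ltac:(by rewrite !inE eqxx orbT).
have jk : j != k.
  by case/andP: ss => + _; apply: contraNneq => jk; rewrite -jE -kE jk.
have rq : freely_reduced (word q.2 ++ flatten [seq word p.2 | p <- s]).
  by rewrite -IH free_wordP.
rewrite -jE /standard_factor /= /supp in pj; rewrite -kE /standard_factor /= /supp in qk.
have := free_wordP p.2; case/lastP: (word p.2) pj => [//|w a].
rewrite all_rcons => /andP[/eqP fa _] rw.
case wqE: (word q.2) qk rq => [|b w'].
  by case: q1; apply/eqP; rewrite -len_eq0 /len wqE.
move=> /andP[/eqP fb _] rq.
rewrite /freely_reduced cat_rcons -cat_rcons cat_cons sorted_cat_cons.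
apply/andP; split => //; case: (w) rw => [|c w0] /= rw.
  by rewrite andbT; apply: contra_neq jk => E; rewrite -fa -fb E.
by rewrite rcons_path rw last_rcons; apply: contra_neq jk => E; rewrite -fa -fb E.
Qed.

(** The first syllable is recovered from the word as the longest prefix whose letters share one
    label; [find] computes its length. *)
Let uniq_syllables s s' :
  syllable_word (standard_factors predT) s -> syllable_word (standard_factors predT) s' ->
  \prod_(p <- s) p.2 = \prod_(p <- s') p.2 -> s = s'.
Proof.
move=> Ps Ps' /(congr1 word); rewrite !word_syllables //.
have lab p s0 : syllable_word (standard_factors predT) (p :: s0) -> exists j,
    [/\ p.1 = standard_factor (pred1 j), all (fun a : letter n => f a.1 == j) (word p.2),
      word p.2 != [::], syllable_word (standard_factors predT) s0 &
      find (fun a : letter n => f a.1 != j) (flatten [seq word q.2 | q <- s0]) = 0%N].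
  move=> [Pp sp]; have [[j _ jE] pj p1] := Pp p (mem_head _ _).
  have Ps0 : syllable_word (standard_factors predT) s0.
    by split; [move=> q qs; apply: Pp; rewrite inE qs orbT | apply: path_sorted sp].
  exists j; split => //.
  - by move: pj; rewrite -jE.
  - by apply: contra_notN p1 => /eqP w0; apply/eqP; rewrite -len_eq0 /len w0.
  case: s0 sp Pp Ps0 => [//|q s0] /= /andP[pq _] Pp _.
  have [[k _ kE] qk q1] := Pp q ltac:(by rewrite !inE eqxx orbT).
  move: qk; rewrite -kE /standard_factor /= /supp.
  case wE: (word q.2) => [|a w] /=; first by case: q1; apply/eqP; rewrite -len_eq0 /len wE.
  move=> /andP[/eqP -> _]; case: eqP => // kj.
  by move: pq; rewrite -jE -kE kj eqxx.
have find_cat j (w v : seq (letter n)) : all (fun a => f a.1 == j) w ->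
    find (fun a => f a.1 != j) v = 0%N -> find (fun a => f a.1 != j) (w ++ v) = size w.
  move=> wj v0; rewrite find_cat v0 addn0 ifF //.
  by apply/hasPn => a /(allP wj) ->.
elim: s s' Ps Ps' => [|p s IH] [|q s'] Ps Ps' //.
- by have [j [_ _ + _ _]] := lab _ _ Ps'; rewrite /=; case: (word q.2).
- by have [j [_ _ + _ _]] := lab _ _ Ps; rewrite /=; case: (word p.2).
have [j [pE pj p0 Ps0 pf]] := lab _ _ Ps; have [k [qE qk q0 Ps0' qf]] := lab _ _ Ps'.
rewrite /= => E.
have jk : j = k.
  case: (word p.2) pj p0 E => [//|a w] /= /andP[/eqP <- _] _.
  by case: (word q.2) qk q0 => [//|b w'] /= /andP[/eqP <- _] _ [-> _].
subst k; have /eqP := E; rewrite eqseq_cat; last first.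
  by rewrite -(find_cat _ _ _ pj pf) -(find_cat _ _ _ qk qf) E.
move=> /andP[/eqP pq /eqP E']; congr (_ :: _); last exact: IH.
rewrite (surjective_pairing p) (surjective_pairing q) pE qE.
by move/word_inj: pq => ->.
Qed.

Lemma subgroup_standard_factor J : subgroup (standard_factor J).
Proof. exact: subgroup_supp. Qed.

Lemma free_product_standard J : free_product (standard_factor J) (standard_factors J).
Proof.
split; first exact: subgroup_standard_factor.
  move=> _ [j Jj <-]; split; first exact: subgroup_standard_factor.
  by apply: standard_factor_sub => i /eqP ->.
move=> h Jh.
have sub s : syllable_word (standard_factors J) s -> syllable_word (standard_factors predT) s.
  by move=> [Ps ss]; split => // p /Ps[[j _ jE] ? ?]; split => //; exists j.
pose l := [seq (standard_factor (pred1 (f a.1)), group_of_word [:: a]) | a <- word h].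
have [||s [Ps sE _]] := @syllable_normal_form _ (standard_factors J) l.
- by move=> _ [j _ <-]; apply: subgroup_standard_factor.
- move=> _ /mapP[a ah ->]; split; last by apply: standard_factor_letter => /=.
  by exists (f a.1) => //; have /allP := Jh; apply.
have {}sE : \prod_(p <- s) p.2 = h.
  rewrite sE /l big_map -[RHS]gw_word.
  by elim: (word h) => [|a w IH]; rewrite ?big_nil ?gw_nil // big_cons IH gw_cons.
exists s; split=> // s' [Ps' s'E].
by apply: uniq_syllables; [exact: sub | exact: sub | rewrite s'E sE].
Qed.

Hypothesis f_surj : forall j, exists i, f i = j.

Lemma standard_factor_inj : injective (fun j => standard_factor (pred1 j)).
Proof.
move=> j k E; have [i ij] := f_surj j.
have : standard_factor (pred1 j) (gen i) by apply: standard_factor_letter; rewrite /= ij.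
by rewrite E /standard_factor /= /supp /= ij andbT => /eqP.
Qed.

Lemma free_factorization_standard :
  free_factorization #|K| (standard_factors predT).
Proof.
split.
- apply: card_eq_trans (inj_card_eq _) _; first by move=> j k _ _; apply: standard_factor_inj.
  apply: card_eq_trans (card_esym card_II).
  have := @inj_card_eq _ _ [set: K] (@enum_rank K) (fun _ _ _ _ => @enum_rank_inj _ _ _).
  move=> /card_esym; rewrite (_ : enum_rank @` _ = [set: 'I_#|K|]).
    by rewrite (_ : [set j | predT j] = [set: K]) //; apply/seteqP.
  by apply/seteqP; split => // i _; exists (enum_val i) => //; rewrite enum_valK.
- move=> _ [j _ <-] E; have [i ij] := f_surj j.
  have : standard_factor (pred1 j) (gen i) by apply: standard_factor_letter; rewrite /= ij.
  by rewrite E /= => /(congr1 (@len n)).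
- have := free_product_standard predT.
  rewrite (_ : standard_factor predT = [set: F]) //.
  by apply/seteqP; split => // g _; apply/allP.
Qed.

End Standard.

Lemma refines_standard n (K L : finType) (f : 'I_n -> K) (g : K -> L) :
  refines (standard_factors f predT) (standard_factors (g \o f) predT).
Proof.
move=> _ [l _ <-]; exists (standard_factors f [pred j | g j == l]).
  by move=> _ [j _ <-]; exists j.
exact: (free_product_standard f [pred j | g j == l]).
Qed.

(** * The vertices [A * <x_t w>] *)

Section Family.
Variables (n : nat) (t : 'I_n).
Local Open Scope group_scope.
Local Open Scope classical_set_scope.
Local Notation F := (free_group n).
Local Notation gw := (@group_of_word n).
Local Notation word := (@free_word n).
Implicit Types (g h r s w : F).

Lemma eq_hom_supp (G : groupType) (p : pred 'I_n) (f1 f2 : F -> G) :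
  {morph f1 : g h / g * h} -> {morph f2 : g h / g * h} ->
  (forall i, p i -> f1 (gen i) = f2 (gen i)) -> forall g, supp p g -> f1 g = f2 g.
Proof.
move=> M1 M2 E g; rewrite /supp -{2 3}[g]gw_word.
elim: (word g) => [|[i b] w IH] /=; first by rewrite gw_nil !morph1.
move=> /andP[pi /IH IHw]; rewrite gw_cons M1 M2 IHw; congr (_ * _).
case: b; last exact: E.
by rewrite -[(i, true)]/(inv_letter (i, false)) gw_inv1 !morphV // -/(gen i) E.
Qed.

Lemma image_stable (T : Type) (f f' : T -> T) (A : set T) : cancel f' f ->
  (forall x, A x -> A (f x)) -> (forall x, A x -> A (f' x)) -> f @` A = A.
Proof.
move=> f'K fA f'A; apply/seteqP; split => x /=; first by move=> [y /fA Ay <-].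
by move=> /f'A Ax; exists (f' x).
Qed.

Lemma eq_im2_factors (G : groupType) (f g : G -> G) (P : set (set G)) :
  (forall A, P A -> f @` A = g @` A) -> im2 f P = im2 g P.
Proof.
move=> fg; apply/seteqP; split => A /= [B PB <-]; exists B => //; first by rewrite fg.
exact: fg.
Qed.

Lemma im2_stable (G : groupType) (f f' : G -> G) (P : set (set G)) : cancel f' f ->
  (forall A x, P A -> A x -> A (f x)) -> (forall A x, P A -> A x -> A (f' x)) ->
  im2 f P = P.
Proof.
move=> f'K fA f'A; rewrite -[RHS](@im2_id _ id) //; apply: eq_im2_factors => A PA.
by rewrite image_id; apply: image_stable f'K (fA A ^~ PA) (f'A A ^~ PA).
Qed.

Lemma lift_hom_supp (p : pred 'I_n) (e : 'I_n -> F) g :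
  (forall i, p i -> supp p (e i)) -> supp p g -> supp p (lift_hom e g).
Proof.
move=> pe; rewrite {1}/supp -{2}[g]gw_word.
elim: (word g) => [|[i b] w IH] /=; first by rewrite gw_nil (morph1 (lift_homM _)).
move=> /andP[pi /IH IHw]; rewrite gw_cons lift_homM; apply: suppM => //.
rewrite lift_hom_word big_cons big_nil mulg1 /eval_letter /=.
by case: b; rewrite ?suppV; apply: pe.
Qed.

Lemma twist_supp (p : pred 'I_n) r s g :
  (p t -> supp p r /\ supp p s) -> supp p g -> supp p (twist t r s g).
Proof.
move=> rs; apply: lift_hom_supp => i pi.
case: eqP => [it|_]; last by rewrite /supp /= pi.
have [pr ps] := rs ltac:(by rewrite -it).
by apply: suppM => //; apply: suppM => //; rewrite /supp /= -it pi.
Qed.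

Section StandardVertex.
Variable f : 'I_n -> bool.
Hypothesis f_surj : forall b, exists i, f i = b.

Lemma standard_vertex_subproof :
  conj_class (standard_factors f predT) \in @es_vertices n.
Proof.
apply/mem_set; exists (standard_factors f predT) => //.
by have := free_factorization_standard f_surj; rewrite card_bool.
Qed.

Definition standard_vertex : es_vertex n := SigSub standard_vertex_subproof.
End StandardVertex.

Lemma val_act_standard f (f_surj : forall b, exists i, f i = b) (F : automorphism n) :
  val (act F (standard_vertex f_surj)) = conj_class (im2 F (standard_factors f predT)).
Proof. by rewrite (conj_class_image (autM F) (autVK F)). Qed.

Definition linked (v v' : es_vertex n) : Prop := v = v' \/ es_edge v v'.

Lemma linked_act f v v' : linked v v' -> linked (act f v) (act f v').
Proof. by case=> [->|vv']; [left | right; apply: act_edge]. Qed.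

Lemma linked_standard (K : finType) (e : 'I_n -> K) (g1 g2 : K -> bool)
    (s1 : forall b, exists i, g1 (e i) = b) (s2 : forall b, exists i, g2 (e i) = b) :
  #|K| = 3 -> (forall k, exists i, e i = k) ->
  linked (standard_vertex s1) (standard_vertex s2).
Proof.
move=> K3 es; have [E|nE] := pselect (standard_vertex s1 = standard_vertex s2); first by left.
right; split => //; exists (standard_factors (g1 \o e) predT),
  (standard_factors (g2 \o e) predT), (standard_factors e predT); split.
- exact: conj_class_refl.
- exact: conj_class_refl.
- by rewrite -K3; apply: free_factorization_standard.
- exact: refines_standard.
- exact: refines_standard.
Qed.

Let trim w := if avoids t w then w else 1.

Let avoids_trim w : avoids t (trim w).
Proof. by rewrite /trim; case: ifP. Qed.

(* Total: an argument that does not avoid x_t is replaced by 1. *)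
Definition twist_aut r s : automorphism n :=
  Automorphism (twistM t (trim r) (trim s)) (twistM t (trim r)^-1 (trim s)^-1)
    (twistK (avoids_trim r) (avoids_trim s)) (twistVK (avoids_trim r) (avoids_trim s)).

Lemma twist_autE r s x : avoids t r -> avoids t s -> twist_aut r s x = twist t r s x.
Proof. by rewrite /= /trim => -> ->. Qed.

Variables (j : 'I_n) (k : 'I_n).
Hypotheses (jt : j != t) (kt : k != t) (jk : j != k).

Let t_surj b : exists i, (i == t) = b.
Proof. by case: b; [exists t; rewrite eqxx | exists j; apply: negbTE]. Qed.

(* The class of A * <x_t>, where A is generated by the other generators. *)
Definition base_vertex : es_vertex n := standard_vertex t_surj.

(* The class of A * <x_t w>. *)
Definition family w : es_vertex n := act (twist_aut 1 w) base_vertex.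

Let av1 : avoids t 1. Proof. exact: supp1. Qed.
Let avM r s : avoids t r -> avoids t s -> avoids t (r * s).
Proof. exact: suppM. Qed.

Lemma family1 : family 1 = base_vertex.
Proof. by apply: act_id => x; rewrite twist_autE // twist11. Qed.

Lemma family_mull r w : avoids t r -> avoids t w ->
  act (twist_aut 1 r) (family w) = family (r * w).
Proof.
move=> ar aw; apply: act_comp => x.
by rewrite !twist_autE ?avM // twist_comp // mulg1.
Qed.

(** The composite twist sends x_t to r x_t w, the conjugate of x_t w r by r^-1. As [r] lies in A,
    this conjugation also preserves A, so the conjugacy class is that of the vertex at [w * r]. *)
Lemma family_mulr r w : avoids t r -> avoids t w ->
  act (twist_aut r 1) (family w) = family (w * r).
Proof.
move=> ar aw; rewrite /family.
rewrite (@act_comp _ _ _ (twist_aut r w)); last first.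
  by move=> x; rewrite !twist_autE // twist_comp // !mul1g.
apply/val_inj; rewrite !val_act_standard.
rewrite -[RHS](conj_class_conj _ r^-1); congr conj_class; rewrite im2_comp.
have af (g : F) : standard_factor (eq_op^~ t) (pred1 false) g <-> avoids t g.
  by rewrite /standard_factor /= /avoids /supp; split; apply: sub_all => a /=;
    rewrite eqbF_neg.
apply: eq_im2_factors => _ [b _ <-].
case: b.
  have ptE x : standard_factor (eq_op^~ t) (pred1 true) x ->
      twist_aut r w x = (twist_aut 1 (w * r) x) ^ r^-1.
    apply: (@eq_hom_supp _ (fun i => pred1 true (i == t)) (twist_aut r w)
      (fun y => (twist_aut 1 (w * r) y) ^ r^-1)) => [|y z|i ti].
    - exact: autM.
    - by rewrite autM conjMg.
    - rewrite (_ : i = t); last by apply/eqP; move: ti => /= /eqP.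
      by rewrite !twist_autE ?avM // !twist_t conjgE invgK mul1g !mulgA mulgK.
  by apply/seteqP; split => _ /= [x tx <-]; exists x => //; rewrite -ptE.
have fixA r' w' (x : F) : avoids t r' -> avoids t w' -> avoids t x -> twist_aut r' w' x = x.
  by move=> ar' aw' ax; rewrite twist_autE // twist_avoids.
have arV : avoids t r^-1 by rewrite /avoids suppV.
have avJ q (x : F) : avoids t q -> avoids t x -> avoids t (x ^ q).
  by move=> aq ax; rewrite conjgE; apply: avM; rewrite ?avM // /avoids suppV.
apply/seteqP; split => _ [x /af ax <-].
  exists (x ^ r); first exact/af/avJ.
  rewrite -[LHS]/((twist_aut 1 (w * r) (x ^ r)) ^ r^-1).
  by rewrite !fixA ?avM ?avJ ?conjgK ?av1 //.
exists (x ^ r^-1); first exact/af/avJ.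
rewrite -[RHS]/((twist_aut 1 (w * r) x) ^ r^-1).
by rewrite !fixA ?avM ?avJ ?av1 ?invgK //.
Qed.

(** The square of x_t w is cyclically reduced for every [w] avoiding x_t, since both letters x_t are
    positive, and it contains the required subword. *)
Lemma family_piece w : avoids t w -> piece t (family w) w.
Proof.
move=> aw; pose P := standard_factors (eq_op^~ t) predT.
exists (im2 (twist_aut 1 w) P), (twist_aut 1 w @` standard_factor (eq_op^~ t) (pred1 true)).
exists (twist_aut 1 w (gen t ^+ 2)); split.
- by rewrite val_act; exists P => //; apply: conj_class_refl.
- by exists (standard_factor (eq_op^~ t) (pred1 true)) => //; exists true.
- exists (gen t ^+ 2) => //; rewrite expg2; apply: suppM; rewrite /supp /= eqxx //.
pose D : seq (arc n) := [:: (false, w, false); (false, w, false)].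
have cD : cyc_reduced (arcs_word t D).
  by apply: cyc_reduced_arcs; rewrite /D //= /proper_arc aw.
have -> : twist_aut 1 w (gen t ^+ 2) = gw (arcs_word t D).
  rewrite /D !gw_arcs_cons gw_nil mulg1 expg2 (autM _) !twist_autE // twist_t mul1g.
  by rewrite !mulgA.
rewrite /piece_word word_gw ?cyc_reduced_reduced //; split => //.
by exists (word w); rewrite /arcs_word /= cats0.
Qed.

(* The transvection x_t |-> x_t x_i^(+-1) fixes the class of <x_t, x_i> * B, where B is
   generated by the other generators. *)
Lemma family_letter a : a.1 != t -> exists v,
  linked base_vertex v /\ linked v (family (gw [:: a])).
Proof.
move=> at_; pose i := a.1.
have [l [lt li]] : exists l, l != t /\ l != i.
  have [ji|ji] := eqVneq j i; last by exists j.
  by exists k; split => //; rewrite -ji eq_sym.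
have s b : exists i', ((i' == t) || (i' == i)) = b.
  by case: b; [exists t; rewrite eqxx | exists l; rewrite (negbTE lt) (negbTE li)].
(* The common refinement has the three classes x_t, x_i and the rest; [g1] isolates x_t, while [g2]
   groups x_t with x_i. *)
pose e i' : option bool := if i' == t then None else Some (i' == i).
have es o : exists i', e i' = o.
  case: o => [[]|]; last by exists t; rewrite /e eqxx.
    by exists i; rewrite /e (negbTE at_) eqxx.
  by exists l; rewrite /e (negbTE lt) (negbTE li).
have K3 : #|{: option bool}| = 3 by rewrite card_option card_bool.
pose g1 (o : option bool) := o == None.
pose g2 (o : option bool) := o != Some false.
have g1E : g1 \o e = (eq_op^~ t).
  by apply/funext => i'; rewrite /g1 /e /=; case: (i' == t).
have g2E : g2 \o e = (fun i' => (i' == t) || (i' == i)).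
  by apply/funext => i'; rewrite /g2 /e /=; case: (i' == t); case: (i' == i).
have s1 b : exists i', g1 (e i') = b.
  by have [i' <-] := t_surj b; exists i'; rewrite -[g1 _]/((g1 \o e) i') g1E.
have s2 b : exists i', g2 (e i') = b.
  by have [i' <-] := s b; exists i'; rewrite -[g2 _]/((g2 \o e) i') g2E.
pose v := standard_vertex s2.
have bE : base_vertex = standard_vertex s1.
  by apply/val_inj => /=; rewrite -g1E.
have ax : avoids t (gw [:: a]) by rewrite /avoids /supp /= at_.
have vE : act (twist_aut 1 (gw [:: a])) v = v.
  apply/val_inj; rewrite val_act_standard; congr conj_class.
  have ti b : pred1 b ((g2 \o e) t) -> supp (fun i' => pred1 b ((g2 \o e) i')) (gw [:: a]).
    by rewrite g2E /supp /= eqxx /= !andbT eqxx orbT.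
  apply: (im2_stable (autVK _)) => _ x [b _ <-]; apply: twist_supp => /ti sa.
    by rewrite /trim av1 ax.
  by rewrite /trim av1 ax !suppV.
exists v; split; first by rewrite bE; apply: linked_standard.
(* As [v] is fixed, the transvection carries the link between [v] and the base vertex to the second
   link. *)
by rewrite -vE; apply: linked_act; rewrite bE; apply: linked_standard.
Qed.

(** Inverting x_j preserves distances in the family but turns powers of [squares] into elements at
    which psi vanishes. *)
Definition flip : F -> F := lift_hom (fun i => if i == j then (gen i)^-1 else gen i).

Lemma flipM : {morph flip : g h / g * h}.
Proof. exact: lift_homM. Qed.

Lemma flip_gen i : flip (gen i) = if i == j then (gen i)^-1 else gen i.
Proof. exact: lift_hom_gen. Qed.

Lemma flipK : involutive flip.
Proof.
apply: (@eq_hom _ _ (flip \o flip) id) => [x y|//|i] /=; first by rewrite !flipM.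
by rewrite flip_gen; case: ifP => ij; rewrite ?(morphV flipM) flip_gen ij ?invgK.
Qed.

Lemma flip_supp (p : pred 'I_n) g : supp p g -> supp p (flip g).
Proof.
by apply: lift_hom_supp => i pi; case: ifP => _; rewrite ?suppV /supp /= pi.
Qed.

Definition flip_aut : automorphism n := Automorphism flipM flipM flipK flipK.

Lemma family_flip w : avoids t w -> act flip_aut (family w) = family (flip w).
Proof.
move=> aw; have aw' : avoids t (flip w) by apply: flip_supp.
have base_flip : act flip_aut base_vertex = base_vertex.
  apply/val_inj; rewrite val_act_standard; congr conj_class.
  by apply: (im2_stable flipK) => _ x [b _ <-]; apply: flip_supp.
rewrite /family -[in RHS]base_flip.
pose f := comp_aut flip_aut (twist_aut 1 w).
rewrite (@act_comp _ _ _ f) // (@act_comp _ _ _ f) // => x.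
apply: (@eq_hom _ _ (twist_aut 1 (flip w) \o flip) (flip \o twist_aut 1 w)) => [y z|y z|i].
- by rewrite /= !flipM !twistM.
- by rewrite /= !twistM !flipM.
rewrite -[LHS]/(twist_aut 1 (flip w) (flip (gen i))) -[RHS]/(flip (twist_aut 1 w (gen i))).
rewrite !twist_autE // flip_gen twist_gen mul1g.
have [->|it] := eqVneq i t.
  by rewrite eq_sym (negbTE jt) twist_t mul1g flipM flip_gen eq_sym (negbTE jt).
rewrite twist_avoids ?flip_gen //.
by case: ifP => _; rewrite /avoids ?suppV /supp /= it.
Qed.

End Family.

(** * Path metrics of graphs *)

Section PathMetric.
Variables (R : realType) (V : eqType) (E : V -> V -> Prop).
Local Open Scope ring_scope.
Local Open Scope classical_set_scope.
Implicit Types (u v w : V) (p q r : V -> R) (l m : R).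
Local Notation path := (polygonal_path E).

Lemma vertex_point_subproof v : edge_point v v 0 \in @realization R V E.
Proof. by apply/mem_set; exists v, v, 0; split; [left | rewrite lexx ler01 | ]. Qed.

Definition vertex_point v : @realization R V E := SigSub (vertex_point_subproof v).

Definition vertex_dist v w : \bar R := path_metric (vertex_point v) (vertex_point w).

Lemma edge_point0 v w : edge_point v w 0 = edge_point v v 0 :> (V -> R).
Proof. by apply/funext => x; rewrite /edge_point !mul0r. Qed.

Lemma edge_point1 v w : edge_point v w 1 = edge_point w w 0 :> (V -> R).
Proof. by apply/funext => x; rewrite /edge_point subrr !mul0r subr0 addr0 add0r. Qed.

Lemma polygonal_path_cat p q r l m : path p q l -> path q r m -> path p r (l + m).
Proof.
move=> pq qr; elim: pq m qr => [p0|p0 q0 r0 l0 m0 s _ IH] m qr; first by rewrite add0r.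
by rewrite -addrA; apply: polygonal_cons s (IH _ qr).
Qed.

Lemma segment_sym p q l : segment E p q l -> segment E q p l.
Proof.
by move=> [u [v [s [t [uv [s01 t01] -> -> ->]]]]]; exists u, v, t, s; rewrite distrC.
Qed.

Lemma polygonal_path_segment p q l : segment E p q l -> path p q l.
Proof. by move=> s; rewrite -[l]addr0; apply: polygonal_cons s _; constructor. Qed.

Lemma polygonal_path_sym p q l : path p q l -> path q p l.
Proof.
elim=> [p0|p0 q0 r0 l0 m0 /segment_sym/polygonal_path_segment s _ IH]; first by constructor.
by rewrite addrC; apply: polygonal_path_cat IH s.
Qed.

Lemma polygonal_path_ge0 p q l : path p q l -> 0 <= l.
Proof.
elim=> [//|p0 q0 r0 l0 m0 [u [v [s [t [_ _ _ _ ->]]]]] _ m0_ge0].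
by rewrite addr_ge0.
Qed.

Definition joined v w : Prop := exists l, path (edge_point v v 0) (edge_point w w 0) l.

Lemma joined_refl v : joined v v. Proof. by exists 0; constructor. Qed.

Lemma joined_sym v w : joined v w -> joined w v.
Proof. by move=> [l /polygonal_path_sym]; exists l. Qed.

Lemma joined_trans v w u : joined v w -> joined w u -> joined v u.
Proof. by move=> [l vw] [m wu]; exists (l + m); apply: polygonal_path_cat wu. Qed.

Lemma joined_edge v w : E v w -> joined v w.
Proof.
move=> vw; exists `|0 - 1|; apply: polygonal_path_segment.
by exists v, w, 0, 1; rewrite edge_point0 edge_point1 !lexx ler01.
Qed.

Lemma vertex_dist_ge0 v w : (0 <= vertex_dist v w)%E.
Proof.
by apply: le_ereal_inf_tmp => _ [l /polygonal_path_ge0 l0 <-]; rewrite lee_fin.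
Qed.

Lemma joined_dist v w : joined v w -> (vertex_dist v w < +oo)%E.
Proof.
move=> [l vw]; apply: le_lt_trans (ltry l).
by apply: ereal_inf_lbound; exists l.
Qed.

Lemma vertex_dist_fine v w : joined v w -> (fine (vertex_dist v w))%:E = vertex_dist v w.
Proof.
move=> /joined_dist vw; apply: fineK.
by rewrite ge0_fin_numE // vertex_dist_ge0.
Qed.

Lemma vertex_dist_sym v w : vertex_dist v w = vertex_dist w v.
Proof.
congr ereal_inf; apply/seteqP.
by split => _ [l /polygonal_path_sym vw <-]; exists l.
Qed.

Section Lipschitz.
Variables (Psi : V -> R) (C : R).
Hypothesis C0 : 0 < C.
Hypothesis Psi_edge : forall u v, E u v -> `|Psi u - Psi v| <= C.

Let ev (s : seq V) p : R := \sum_(x <- s) p x * Psi x.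

Let ev_edge s u v t : uniq s -> u \in s -> v \in s ->
  ev s (edge_point u v t) = (1 - t) * Psi u + t * Psi v.
Proof.
move=> us us_ vs; rewrite /ev.
have delta x : x \in s -> \sum_(y <- s) (y == x)%:R * Psi y = Psi x.
  move=> xs; rewrite (bigD1_seq x) //= eqxx mul1r big1_seq ?addr0 //.
  by move=> y /andP[/negbTE -> _]; rewrite mul0r.
rewrite -[in RHS](delta u) // -[in RHS](delta v) // !mulr_sumr -big_split /=.
by apply: eq_bigr => x _; rewrite /edge_point; ring.
Qed.

(* A path only meets finitely many edges, so that the piecewise linear extension of
   Psi along it is given by a finite sum. *)
Let path_lipschitz p q l : path p q l -> exists s0 : seq V, forall s,
  uniq s -> {subset s0 <= s} -> `|ev s p - ev s q| <= C * l.
Proof.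
elim=> [p0|p0 q0 r0 l0 m0 [u [v [a [b [uv _ -> -> ->]]]]] _ [s0 Hs0]].
  by exists [::] => s _ _; rewrite subrr normr0 mulr0.
exists (u :: v :: s0) => s us sub.
rewrite mulrDr; apply: le_trans (ler_distD (ev s (edge_point u v b)) _ _) _.
apply: lerD; last by apply: Hs0 => // x xs; apply: sub; rewrite !inE xs !orbT.
rewrite !ev_edge ?sub ?inE ?eqxx ?orbT //.
rewrite (_ : _ - _ = (b - a) * (Psi u - Psi v)); last by ring.
by rewrite normrM (distrC b) mulrC ler_wpM2r ?Psi_edge.
Qed.

Lemma vertex_dist_lipschitz v w : joined v w ->
  `|Psi v - Psi w| <= C * fine (vertex_dist v w).
Proof.
move=> vw; rewrite mulrC -ler_pdivrMr // -lee_fin vertex_dist_fine //.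
apply: le_ereal_inf_tmp => _ [l /path_lipschitz[s0 Hs0] <-].
rewrite lee_fin ler_pdivrMr // mulrC.
have := Hs0 (undup (v :: w :: s0)) (undup_uniq _).
rewrite !ev_edge ?undup_uniq ?mem_undup ?inE ?eqxx ?orbT // !subr0 !mul1r !mul0r !addr0.
by apply=> x xs; rewrite mem_undup !inE xs !orbT.
Qed.
End Lipschitz.

Section Isometry.
Variables f g : V -> V.
Hypotheses (fK : cancel f g) (gK : cancel g f).
Hypothesis fE : forall u v, E u v -> E (f u) (f v).

(** Points of the realization are functions on the vertices, so [f] acts on them by composition with
    its inverse [g]. *)
Let push u v (t : R) : edge_point u v t \o g = edge_point (f u) (f v) t.
Proof.
have gE x y : (g x == y) = (x == f y) by apply/eqP/eqP => [<-|->].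
by apply/funext => x; rewrite /edge_point /= !gE.
Qed.

Lemma polygonal_path_push p q l : path p q l -> path (p \o g) (q \o g) l.
Proof.
elim=> [p0|p0 q0 r0 l0 m0 [u [v [a [b [uv ab -> -> ->]]]]] _ IH]; first by constructor.
apply: (polygonal_cons _ IH); exists (f u), (f v), a, b.
by split; rewrite ?push //; apply: fE.
Qed.

Lemma joined_push v w : joined v w -> joined (f v) (f w).
Proof. by move=> [l /polygonal_path_push]; rewrite !push; exists l. Qed.

Lemma vertex_dist_push v w : (vertex_dist (f v) (f w) <= vertex_dist v w)%E.
Proof.
apply: le_ereal_inf_tmp => _ [l vw <-]; apply: ereal_inf_lbound; exists l => //.
by have := polygonal_path_push vw; rewrite /= !push.
Qed.
End Isometry.

(** Clearing the halves in the Gromov products turns the inequality into the comparison of the three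
    sums of opposite distances, with error [2 * delta]. *)
Lemma gromov_four_point : gromov_hyperbolic (@path_metric R V E) ->
  exists2 delta : R, 0 <= delta & forall d o x y z,
    d = (fun v w => fine (vertex_dist v w)) ->
    joined x o -> joined y o -> joined z o ->
    d x y + d z o <= Num.max (d x z + d y o) (d z y + d x o) + 2 * delta.
Proof.
move=> [delta delta0 H]; exists delta => // d o x y z dE xo yo zo.
have dvE v w : fine (path_metric (vertex_point v) (vertex_point w)) = d v w by rewrite dE.
have := H (vertex_point o) (vertex_point x) (vertex_point y) (vertex_point z)
  (joined_dist xo) (joined_dist yo) (joined_dist zo).
rewrite /gromov_product !dvE lerBlDr ge_min.
move=> H'; rewrite -lerBlDr le_max; apply/orP.
by case/orP: H' => H'; [left | right]; lra.
Qed.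

End PathMetric.

(** * A rich word *)

Section RichWord.
Variables (n : nat) (t j k : 'I_n).
Hypotheses (jt : j != t) (kt : k != t) (jk : j != k).
Local Open Scope group_scope.
Local Notation word := (@free_word n).
Local Notation gw := (@group_of_word n).

Let others : seq 'I_n := [seq i <- enum 'I_n | (i != t) && (i != j)].

Definition squares_word : seq (letter n) :=
  flatten [seq [:: (i, false); (i, false)] | i <- j :: others].

(** Each square joins the two letters of one generator in the Whitehead graph, and each passage to
    the next square joins consecutive generators. The final x_j closes the graph into a single
    circuit, which has no cut vertex. *)
Definition rich_word : seq (letter n) := rcons squares_word (j, false).

Let circuit : seq (letter n) := [seq (i, b) | i <- j :: others, b <- [:: false; true]].

Let others_mem i : (i \in j :: others) = (i != t).
Proof.
rewrite inE mem_filter mem_enum andbT.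
by case: eqVneq => [->|ij] /=; rewrite ?jt ?andbT.
Qed.

Let mem_circuit (a : letter n) : (a \in circuit) = (a.1 != t).
Proof.
case: a => i b; rewrite -others_mem; apply/allpairsP/idP => [[[i' b'] [? _ [-> _]]]//|/= il].
by exists (i, b); split => //; case: (b).
Qed.

Let uniq_circuit : uniq circuit.
Proof.
apply: allpairs_uniq => [||[? ?] [? ?] _ _ /= [-> ->]//] //=.
by rewrite filter_uniq ?enum_uniq // andbT mem_filter eqxx andbF.
Qed.

(** Cutting a circuit at [y] leaves a path, along which [kappa] is constant. *)
Lemma cycle_constant (T U : eqType) (kappa : T -> U) (y : T) (s : seq T) : uniq s ->
  cycle (fun a b => (a != y) && (b != y) ==> (kappa a == kappa b)) s ->
  forall a b, a \in s -> b \in s -> a != y -> b != y -> kappa a = kappa b.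
Proof.
move=> us; set e := (X in cycle X _) => ces.
have path_const a p : y \notin a :: p -> path e a p -> {in p, forall b, kappa b = kappa a}.
  elim: p a => [//|c p IH] a; rewrite !inE !negb_or => /and3P[ya yc yp] /= /andP[eac pcp].
  have ac : kappa c = kappa a.
    by move: eac; rewrite /e eq_sym ya eq_sym yc /= => /eqP.
  move=> b; rewrite inE => /orP[/eqP -> //|bp]; rewrite -ac; apply: IH bp => //.
  by rewrite inE negb_or yc.
have sorted_const p : y \notin p -> sorted e p ->
    forall a b, a \in p -> b \in p -> kappa a = kappa b.
  case: p => [//|c p] yp sp.
  have H d : d \in c :: p -> kappa d = kappa c.
    by rewrite inE => /orP[/eqP -> //|]; apply: path_const.
  by move=> a b /H -> /H ->.
move=> a b as_ bs ay b_y; have [ys|ys] := boolP (y \in s); last first.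
  case: (s) as_ bs ces ys => [//|c p] as_ bs; rewrite /= rcons_path => /andP[pp _] ys.
  exact: (sorted_const (c :: p)).
have [i p rE] := rot_to ys; have : cycle e (y :: p) by rewrite -rE rot_cycle.
rewrite /= rcons_path => /andP[/path_sorted pp _].
have mp d : d \in s -> d != y -> d \in p.
  by rewrite -(mem_rot i) rE inE => /orP[/eqP ->|//]; rewrite eqxx.
apply: (sorted_const p) => //; try exact: mp.
by have := us; rewrite -(rot_uniq i) rE => /andP[].
Qed.

Lemma rich_rich_word : rich t rich_word.
Proof.
move=> kappa y su a b at_ bt ay b_y.
pose e a b := (a != y) && (b != y) ==> (kappa a == kappa b).
apply: (cycle_constant uniq_circuit _ _ _ ay b_y); rewrite ?mem_circuit //.
have step i l z : path (whitehead_rel kappa y) (i, false)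
      (rcons ((i, false) :: flatten [seq [:: (i, false); (i, false)] | i <- l]) (z, false)) ->
    path e (i, false)
      (rcons ((i, true) :: [seq (i, b) | i <- l, b <- [:: false; true]]) (z, false)).
  have square i0 : whitehead_rel kappa y (i0, false) (i0, false) = e (i0, false) (i0, true).
    by rewrite /whitehead_rel /e andbC [X in _ ==> X]eq_sym.
  elim: l i => [|i' l IH] i /=; first by rewrite square.
  by rewrite square => /and3P[-> /= H1 H2]; apply/andP; split; [exact: H1 | exact: IH].
exact: (step j others j).
Qed.

Let all_cat_reduce (q : pred (letter n)) x y :
  all q x -> all q y -> all q (cat_reduce x y).
Proof.
move=> + qy; elim: x => [//|a x IH] /= /andP[qa /IH].
case: (cat_reduce x y) => [|b s] /=; first by rewrite qa.
by case: eqP => _ /andP[qb qs] /=; rewrite ?qa ?qb.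
Qed.

Let positive_reduced (x : seq (letter n)) : all (fun a => ~~ a.2) x -> freely_reduced x.
Proof.
elim: x => [//|[i b] [//|[i' b'] x] IH] /and3P[/= nb nb' px].
rewrite /inv_letter xpair_eqE negb_and /=.
apply/andP; split; first by move: nb nb'; case: (b); case: (b'); rewrite ?orbT.
by apply: IH; apply/andP; split.
Qed.

Definition squares : free_group n := gw squares_word.

Lemma avoids_squares : avoids t squares.
Proof.
apply: supp_gw; apply/allP => a /flattenP[_ /mapP[i il ->]].
by rewrite !inE orbb => /eqP -> /=; rewrite -others_mem.
Qed.

Let positive_pow i : all (fun a => ~~ a.2) (flatten (nseq i squares_word)).
Proof.
apply/allP => a /flattenP[x]; rewrite mem_nseq => /andP[_ /eqP ->].
by move=> /flattenP[_ /mapP[l _ ->]]; rewrite !inE orbb => /eqP ->.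
Qed.

Let word_squaresX i : word (squares ^+ i) = flatten (nseq i squares_word).
Proof. by rewrite gwX word_gw // positive_reduced. Qed.

(** Every copy of [squares_word] except the last is followed by x_j and so starts an occurrence of
    [rich_word]. The inverse word has only negative letters and contributes nothing. *)
Lemma psi_squares i : ((i%:Z - 1) <= psi rich_word (squares ^+ i)%g)%R.
Proof.
rewrite /psi [occ _ (inv_word _)](@occ_notin _ _ _ (j, false)).
- rewrite word_squaresX subr0 lerBlDr.
  suff : (i <= (occ rich_word (flatten (nseq i squares_word))).+1)%N by lia.
  elim: i => [//|[//|i] IH]; rewrite ltnS.
  pose y := flatten (nseq i.+1 squares_word).
  have yE : y = (j, false) :: behead y by [].
  have pre : prefix rich_word (squares_word ++ y).
    by apply/prefixP; exists (behead y); rewrite /rich_word cat_rcons -yE.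
  exact: leq_trans IH (ltn_occ_prefix _ pre).
- by rewrite /rich_word mem_rcons mem_head.
- rewrite word_squaresX /inv_word mem_rev; apply/mapP => -[a al] /(congr1 snd) /=.
  by have /allP/(_ a al) := positive_pow i; case: a.2.
Qed.

(** After the flip x_j occurs only negatively and the other generators only positively. As
    [rich_word] contains both x_j and x_k positively, it occurs neither in this word nor in its
    inverse. *)
Lemma psi_flip_squares i : psi rich_word (flip j (squares ^+ i)%g) = 0%R.
Proof.
pose q (a : letter n) := a.2 == (a.1 == j).
have kl : (k, false) \in rich_word.
  rewrite mem_rcons inE; apply/orP; right; apply/flattenP.
  exists [:: (k, false); (k, false)]; last exact: mem_head.
  by apply/mapP; exists k; rewrite ?others_mem.
have qf : all q (word (flip j (squares ^+ i))).
  rewrite -[squares ^+ i]gw_word word_squaresX.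
  elim: (flatten _) (positive_pow i) => [|[l b] x IH] /=; first by rewrite gw_nil (morph1 (flipM j)).
  move=> /andP[nb /IH qx]; rewrite gw_cons flipM; apply: all_cat_reduce => //.
  case: b nb => // _; rewrite -/(gen l) flip_gen.
  by case: ifP => lj; rewrite /= /q /= lj eqxx.
rewrite /psi (@occ_notin _ _ _ (j, false)); last first.
- by apply/negP => /(allP qf); rewrite /q /= eqxx.
- by rewrite /rich_word mem_rcons mem_head.
rewrite (@occ_notin _ _ _ (k, false)) ?subrr //.
apply/negP; rewrite /inv_word mem_rev => /mapP[[l b] /(allP qf)/eqP /= qlb].
rewrite /inv_letter /= => -[kl']; rewrite -kl' eq_sym (negbTE jk) in qlb.
by rewrite qlb.
Qed.

End RichWord.

(* Writing a = 2 ^ i and G i = F a / a, the hypothesis says that the nonnegative G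
   decreases by at least kap / 2 up to a summable error. *)
Lemma no_doubling_decrease (R : realType) (F : nat -> R) (kap c : R) :
  (0 < kap)%R -> (0 <= c)%R -> (forall a, 0 <= F a)%R ->
  (forall a, F a.*2 + kap * a%:R <= 2 * F a + c)%R -> False.
Proof.
move=> kap0 c0 F0 HF.
(* Passing to F + c absorbs the constant: its value at 2a is at most twice its value at a, minus kap
   a. *)
have key i : (F (2 ^ i)%N <= (2 ^ i)%N%:R * (F 1%N + c - i%:R * (kap / 2)) - c)%R.
  elim: i => [|i IH]; first by rewrite expn0; lra.
  have := HF (2 ^ i)%N; rewrite -mul2n -expnS.
  have -> : ((2 ^ i.+1)%N%:R = 2 * (2 ^ i)%N%:R :> R)%R by rewrite expnS natrM.
  have -> : (i.+1%:R = i%:R + 1 :> R)%R by rewrite -natr1.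
  move: IH; move: (F (2 ^ i)%N) (F (2 ^ i.+1)%N) (i%:R : R)%R => x y z.
  move: ((2 ^ i)%N%:R : R)%R => p; nra.
have [i iM] : exists i : nat, (F 1%N + c < i%:R * (kap / 2))%R.
  exists (Num.bound ((F 1%N + c) / (kap / 2))).
  rewrite -ltr_pdivrMr; last by lra.
  apply: archi_boundP; apply: divr_ge0; [by rewrite addr_ge0 | lra].
have := key i; have := F0 (2 ^ i)%N.
have : (0 < (2 ^ i)%N%:R :> R)%R by rewrite ltr0n expn_gt0.
move: iM; move: (F (2 ^ i)%N) (F 1%N) (i%:R : R)%R ((2 ^ i)%N%:R : R)%R => x y z p; nra.
Qed.

(** * Non-hyperbolicity *)

Section BiinvariantMetric.
Variables (R : realType) (n : nat) (t j k : 'I_n).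
Hypotheses (jt : j != t) (kt : k != t) (jk : j != k).
Local Open Scope group_scope.
Implicit Types (g h x y : free_group n).

Let u := rich_word t j.

Variables (D : free_group n -> free_group n -> R) (delta K : R).
Hypothesis delta0 : (0 <= delta)%R.
Hypothesis K0 : (0 < K)%R.
Hypothesis D_ge0 : forall x y, (0 <= D x y)%R.
Hypothesis D_sym : forall x y, D x y = D y x.
Hypothesis D_mull : forall g x y,
  avoids t g -> avoids t x -> avoids t y -> D (g * x) (g * y) = D x y.
Hypothesis D_mulr : forall g x y,
  avoids t g -> avoids t x -> avoids t y -> D (x * g) (y * g) = D x y.
Hypothesis D_flip : forall x y,
  avoids t x -> avoids t y -> D (flip j x) (flip j y) = D x y.
Hypothesis D_lower : forall x y (N : int), avoids t x -> avoids t y ->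
  (N <= `|psi u x - psi u y|)%R -> (N%:~R - K <= K * D x y)%R.
Hypothesis four : forall o x y z,
  avoids t o -> avoids t x -> avoids t y -> avoids t z ->
  (D x y + D z o <= Num.max (D x z + D y o) (D z y + D x o) + 2 * delta)%R.

Lemma biinvariant_not_hyperbolic : False.
Proof.
pose g := squares t j; pose h := flip j g.
have ag : avoids t g by apply: avoids_squares.
have ah : avoids t h by apply: flip_supp.
have av1 : avoids t 1 by apply: supp1.
have agX a : avoids t (g ^+ a) by apply: suppX.
have ahX a : avoids t (h ^+ a) by apply: suppX.
have ahV a : avoids t (h ^+ a)^-1 by rewrite /avoids suppV; apply: suppX.
have avM x y : avoids t x -> avoids t y -> avoids t (x * y) by apply: suppM.
have hE a : h ^+ a = flip j (g ^+ a) by rewrite /h (morphX (flipM j)).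
have flip1 : flip j 1 = 1 := morph1 (flipM j).
pose F a := D 1 (g ^+ a).
have Fh a : D 1 (h ^+ a) = F a by rewrite hE -[in LHS]flip1 D_flip.
pose X a := D (g ^+ a) (h ^+ a); pose Y a := D 1 (g ^+ a * h ^+ a).
(* The four sides of this square all have length [F a]; its diagonals are [X a] and [Y a]. *)
have first_square a : (X a + Y a <= 2 * F a + 2 * delta)%R.
  have := four av1 (agX a) (ahX a) (avM _ _ (agX a) (ahX a)).
  have -> : D (g ^+ a) (g ^+ a * h ^+ a) = F a.
    by rewrite -{1}[g ^+ a]mulg1 D_mull.
  have -> : D (g ^+ a * h ^+ a) (h ^+ a) = F a.
    by rewrite -{2}[h ^+ a]mul1g D_mulr // D_sym.
  rewrite (D_sym (h ^+ a) 1) Fh (D_sym _ 1) (D_sym (g ^+ a) 1) -/(F a) -/(X a) -/(Y a).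
  rewrite maxxx; lra.
(* The roles are exchanged: both diagonals equal [F a.*2], and the opposite sides are [X a] twice
   and [Y a] twice. *)
have second_square a : (F a.*2 <= Num.max (X a) (Y a) + delta)%R.
  have := four av1
    (avM _ _ (agX a) (ahX a)) (avM _ _ (agX a) (ahV a)) (avM _ _ (agX a) (agX a)).
  rewrite !D_mull //.
  have -> : D (h ^+ a) (h ^+ a)^-1 = F a.*2.
    rewrite -(D_mulr (ahX a)) // mulVg -expgnDr addnn D_sym; exact: Fh.
  have -> : D (g ^+ a * (h ^+ a)^-1) 1 = X a.
    by rewrite -(D_mulr (ahX a)) ?avM // mulgVK mul1g.
  have -> : D (g ^+ a) (h ^+ a)^-1 = Y a.
    by rewrite -(D_mulr (ahX a)) // mulVg D_sym.
  rewrite (D_sym (h ^+ a)) -/(X a) (D_sym _ 1) -/(Y a) -expgnDr addnn (D_sym _ 1) -/(F _).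
  have -> : Num.max (X a + X a)%R (Y a + Y a)%R = (2 * Num.max (X a) (Y a))%R.
    by rewrite maxr_pMr //; congr Num.max; ring.
  by move: (Num.max _ _) => M; lra.
have psi1 : psi u 1 = 0%R.
  by rewrite /u -(psi_flip_squares jt kt jk 0) expg0 flip1.
have Xlow a : ((a%:Z - 1)%:~R - K <= K * X a)%R.
  apply: D_lower => //; rewrite hE (psi_flip_squares jt kt jk) subr0.
  by apply: le_trans (ler_norm _); exact: (psi_squares jt kt jk).
pose U := size u.
have Ylow a : ((a%:Z - 1 - (3 * U)%:Z)%:~R - K <= K * Y a)%R.
  apply: D_lower; rewrite ?avM // psi1.
  have := psiM u (g ^+ a) (h ^+ a); rewrite hE (psi_flip_squares jt kt jk) -hE.
  have := psi_squares jt kt jk a; rewrite -/g -/u -/U.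
  move: (psi u (g ^+ a)) (psi u (g ^+ a * h ^+ a)) => p q; lia.
(* [c0] serves both linear bounds; the defect [3 * U] comes from the product in [Y]. *)
pose c0 : R := ((1 + (3 * U)%N%:R + K) / K)%R.
have low a : (K^-1 * a%:R - c0 <= Num.min (X a) (Y a))%R.
  have XK : (a%:R - 1 - (3 * U)%N%:R - K <= K * X a)%R.
    have := Xlow a; rewrite intrB; have : (0 <= (3 * U)%N%:R :> R)%R by rewrite ler0n.
    lra.
  have YK : (a%:R - 1 - (3 * U)%N%:R - K <= K * Y a)%R.
    by have := Ylow a; rewrite !intrB.
  rewrite le_min /c0 mulrC -mulrBl !ler_pdivrMr // ![(_ * K)%R]mulrC.
  by apply/andP; split; [move: XK | move: YK]; lra.
(* Since max = X + Y - min, the two squares and [low] bound [F a.*2] by 2 F a - a / K + c0 + 3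
   delta; the constant leaves one [delta] to spare. *)
apply: (@no_doubling_decrease R F K^-1 (3 * delta + c0 + delta)%R).
- by rewrite invr_gt0.
- have : (0 <= c0)%R.
    by apply: divr_ge0; [rewrite !addr_ge0 ?ler0n // ltW | apply: ltW].
  by move: delta0; lra.
- by move=> a; apply: D_ge0.
move=> a; have := first_square a; have := second_square a; have := low a.
have : (Num.min (X a) (Y a) + Num.max (X a) (Y a) = X a + Y a)%R by rewrite addr_min_max.
move: delta0 (Num.min _ _) (Num.max _ _) (K^-1 * a%:R)%R => d0 p q z.
clearbody F X Y; lra.
Qed.


End BiinvariantMetric.

(** * Application to the edge splitting graph *)

Section EdgeSplittingGraph.
Variables (R : realType) (n : nat) (t j k : 'I_n).
Hypotheses (jt : j != t) (kt : k != t) (jk : j != k).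
Local Open Scope group_scope.
Local Notation gw := (@group_of_word n).
Local Notation V := (family jt).
Local Notation joined := (@joined R _ (@es_edge n)).
Local Notation vertex_dist := (@vertex_dist R _ (@es_edge n)).
Implicit Types (g h x y : free_group n) (v w : es_vertex n).

Let D x y : R := fine (vertex_dist (V x) (V y)).

Lemma actVK (f : automorphism n) : cancel (act (inv_aut f)) (act f).
Proof. by case: f => f f' fM f'M fK f'K; apply: (actK (inv_aut _)). Qed.

Lemma vertex_dist_act f v w : vertex_dist (act f v) (act f w) = vertex_dist v w.
Proof.
apply/eqP; rewrite eq_le; apply/andP; split.
  exact: (vertex_dist_push _ (actK f) (actVK f) (@act_edge n f)).
rewrite -{1}[v](actK f) -{1}[w](actK f).
exact: (vertex_dist_push _ (actVK f) (actK f) (@act_edge n (inv_aut f))).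
Qed.

Lemma joined_act f v w : joined v w -> joined (act f v) (act f w).
Proof. exact: (joined_push (actK f) (actVK f) (@act_edge n f)). Qed.

Lemma joined_linked v w : linked v w -> joined v w.
Proof. by case=> [->|/joined_edge]; [apply: joined_refl | apply]. Qed.

(** Induction on the word: [family_letter] joins the base vertex to the vertex of the first letter,
    and left translation by that letter moves the remaining path. This puts the whole family in one
    component, where distances are finite. *)
Lemma joined_family x : avoids t x -> joined (V 1) (V x).
Proof.
rewrite -[x]gw_word /avoids; have := free_wordP x.
elim: (free_word x) => [_ _|a s IH rs]; first by rewrite gw_nil; apply: joined_refl.
rewrite /supp word_gw // => /andP[at_ as_].
have avs : avoids t (gw s) by apply: supp_gw.
have ava : avoids t (gw [:: a]) by rewrite /avoids /supp /= at_.
rewrite gw_cons -(family_mull jt ava avs).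
have [v [bv va]] := family_letter jt kt jk at_.
apply: (@joined_trans _ _ _ _ (V (gw [:: a]))).
  rewrite family1; apply: joined_trans (joined_linked bv) _; exact: joined_linked.
have -> : V (gw [:: a]) = act (twist_aut t 1 (gw [:: a])) (V 1).
  by rewrite family_mull ?mulg1 // /avoids supp1.
apply/joined_act/IH => //; exact: path_sorted rs.
Qed.

Lemma joined_families x y : avoids t x -> avoids t y -> joined (V x) (V y).
Proof.
move=> /joined_family/joined_sym ax /joined_family ay; exact: joined_trans ax ay.
Qed.

Let D_mull g x y : avoids t g -> avoids t x -> avoids t y -> D (g * x) (g * y) = D x y.
Proof.
move=> ag ax ay; rewrite /D -(family_mull jt ag ax) -(family_mull jt ag ay).
by rewrite vertex_dist_act.
Qed.

Let D_mulr g x y : avoids t g -> avoids t x -> avoids t y -> D (x * g) (y * g) = D x y.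
Proof.
move=> ag ax ay; rewrite /D -(family_mulr jt ag ax) -(family_mulr jt ag ay).
by rewrite vertex_dist_act.
Qed.

Let D_flip x y : avoids t x -> avoids t y -> D (flip j x) (flip j y) = D x y.
Proof.
move=> ax ay; rewrite /D -(family_flip jt ax) -(family_flip jt ay).
by rewrite vertex_dist_act.
Qed.

Let D_sym x y : D x y = D y x. Proof. by rewrite /D vertex_dist_sym. Qed.

Let D_ge0 x y : (0 <= D x y)%R.
Proof. by rewrite fine_ge0 // vertex_dist_ge0. Qed.

Let u := rich_word t j.
(** The same constant bounds the variation of [vertex_psi] along an edge and twice its error of
    [12 * size u] at a piece. *)
Let K : R := ((24 * size u)%N%:R)%R.

Let K0 : (0 < K)%R.
Proof. by rewrite ltr0n muln_gt0 /u /rich_word size_rcons. Qed.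

Let D_lower x y (N : int) : avoids t x -> avoids t y ->
  (N <= `|psi u x - psi u y|)%R -> (N%:~R - K <= K * D x y)%R.
Proof.
move=> ax ay Nxy.
have n1 : (1 < n)%N.
  by have := max_card (mem [:: t; j]); rewrite card_ord (card_uniqP _) //= inE eq_sym jt.
have u0 : u != [::] by rewrite /u /rich_word; case: (squares_word _ _).
have ru : rich t u by apply: rich_rich_word.
have KE : (K = ((24 * size u)%:Z)%:~R)%R by [].
pose Psi v : R := ((vertex_psi t u v)%:~R)%R.
have PsiE v w : es_edge v w -> (`|Psi v - Psi w| <= K)%R.
  move=> vw; rewrite /Psi -intrB -intr_norm KE ler_int.
  exact: (vertex_psi_edge ru u0 n1 vw).
apply: le_trans (vertex_dist_lipschitz K0 PsiE (joined_families ax ay)).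
rewrite lerBlDr /Psi -intrB -intr_norm KE -intrD ler_int.
have := vertex_psi_piece ru u0 n1 (family_piece jt ax).
have := vertex_psi_piece ru u0 n1 (family_piece jt ay).
move: Nxy; move: (psi u x) (psi u y) (vertex_psi _ _ _) (vertex_psi _ _ _); lia.
Qed.

Theorem edge_splitting_graph_not_hyperbolic :
  ~ gromov_hyperbolic (@path_metric R (es_vertex n) (@es_edge n)).
Proof.
move=> /gromov_four_point[delta d0 H].
apply: (biinvariant_not_hyperbolic jt kt jk d0 K0 D_ge0 D_sym D_mull D_mulr D_flip D_lower).
by move=> o x y z ao ax ay az; apply: (H _ _ _ _ _ erefl); apply: joined_families.
Qed.

End EdgeSplittingGraph.

Theorem corollary5p5 (R : realType) (n : nat) (hn : (2 < n)%N) :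
  ~ gromov_hyperbolic (@path_metric R (es_vertex n) (@es_edge n)).
Proof.
(* The generators of index 0, 1 and 2 serve as x_t, x_j and x_k. *)
exact: (@edge_splitting_graph_not_hyperbolic R n
  (Ordinal (ltnW (ltnW hn))) (Ordinal (ltnW hn)) (Ordinal hn)).
Qed.
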